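(* Let $W=(W_i,w_i)_{i\in I}$ and $V=(V_i,v_i)_{i\in I}$ be families of closed subspaces of a Hilbert space $\mathcal H$ with weights $w_i,v_i>0$. Then $W$ and $V$ are Bessel fusion sequences (respectively fusion frames, respectively fusion Riesz sequences) with frame bounds $A_W,B_W$ and $A_V,B_V$, respectively, if and only if $W\otimes V:=\left(W_j\otimes V_i,\,v_iw_j\right)_{i,j\in I}$ is a Bessel fusion sequence (respectively fusion frame, respectively fusion Riesz sequence) for $S_2(\mathcal H)$ with frame bounds $A_VA_W$ and $B_VB_W$.
   Context: $S_2(\mathcal H)$ is the Hilbert space of Hilbert-Schmidt operators on $\mathcal H$ with inner product $\langle U_1,U_2\rangle=\mathrm{trace}(U_1^*U_2)$. $W_j\otimes V_i$ denotes the space of Hilbert-Schmidt operators from $V_i$ to $W_j$, viewed as a closed subspace of $S_2(\mathcal H)$ (extending operators by $0$ on $V_i^\perp$), i.e. $W_j\otimes V_i=\{\pi_{W_j}O\pi_{V_i}:O\in S_2(\mathcal H)\}$, where $\pi_U$ is the orthogonal projection onto $U$. For a Hilbert space $\mathcal K$, closed subspaces $U_i\subseteq\mathcal K$ and weights $u_i>0$: $(U_i,u_i)$ is a Bessel fusion sequence with bound $B$ if $\sum_iu_i^2\|\pi_{U_i}f\|^2\le B\|f\|^2$ for all $f\in\mathcal K$ (in this case only the upper bound is relevant); it is a fusion frame with bounds $0<A\le B<\infty$ if in addition $A\|f\|^2\le\sum_iu_i^2\|\pi_{U_i}f\|^2$ for all $f\in\mathcal K$; it is a fusion Riesz sequence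 with bounds $0<A\le B<\infty$ if $A\sum_{j\in J}\|f_j\|^2\le\|\sum_{j\in J}u_jf_j\|^2\le B\sum_{j\in J}\|f_j\|^2$ for every finite set $J$ of indices and all $f_j\in U_j$.
   Formalization: In the ''if'' direction the bounds of W and V are not fixed in advance: any bounds A, B of W⊗V factor as A_V A_W, B_V B_W for some bounds of W and V; for Bessel and Riesz it also excludes the case where exactly one of the families W, V consists only of zero subspaces. *)

(* Defs.v *)
From HB Require Import structures.
From mathcomp Require Import all_boot all_order ssralg ssrnum finmap.
From mathcomp Require Import all_classical reals ereal topology normedtype esum.
From mathcomp Require Import complex.
From mathcomp Require summability.
From mathcomp Require Import ring lra.
Import Order.TTheory GRing.Theory Num.Theory.
Import numFieldNormedType.Exports.
Set Implicit Arguments. Unset Strict Implicit. Unset Printing Implicit Defensive.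
Local Open Scope classical_set_scope.
Local Open Scope ring_scope.

(* The scalar field of a Hilbert space, over the reals R: these axioms leave
   only R itself and R[i], the instances given below.  As usual in MathComp the
   norm of a normed module over such a field takes its values in the field. *)
Record scalarField (R : realType) := ScalarField {
  scalar_sort :> numFieldType;
  ofR : {rmorphism R -> scalar_sort};
  re : scalar_sort -> R;
  cj : {rmorphism scalar_sort -> scalar_sort};
  ofR_le : {mono ofR : x y / x <= y};
  mul_cj : forall z, z * cj z = `|z| ^+ 2;
  add_cj : forall z, z + cj z = ofR (re z) *+ 2 }.
Arguments ofR {R} s.
Arguments re {R s}.
Arguments cj {R s}.

Section Instances.
Variable R : realType.

Let real_mul_cj (z : R) : z * idfun z = `|z| ^+ 2.
Proof. by rewrite real_normK ?num_real. Qed.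

Let real_add_cj (z : R) : z + idfun z = idfun (idfun z) *+ 2.
Proof. by rewrite mulr2n. Qed.

Definition realScalars : scalarField R :=
  @ScalarField R R idfun idfun idfun (fun _ _ => erefl) real_mul_cj real_add_cj.

Let complex_mul_cj (z : R[i]) : z * conjc z = `|z| ^+ 2.
Proof.
by case: z => a b; rewrite -add_Re2_Im2; simpc; rewrite [b * a]mulrC addNr.
Qed.

Let complex_add_cj (z : R[i]) : z + conjc z = real_complex R (complex.Re z) *+ 2.
Proof. by rewrite addcJ mulr_natl. Qed.

Definition complexScalars : scalarField R :=
  @ScalarField R R[i] (real_complex R) (@complex.Re R) (@conjc R) (@lecR R)
    complex_mul_cj complex_add_cj.

End Instances.

Section ScalarTheory.
Variables (R : realType) (F : scalarField R).
Implicit Types (r s : R) (a b z : F).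

Lemma ofR_inj : injective (ofR F).
Proof. exact: fmorph_inj. Qed.

Lemma ofR_ge0 r : (0 <= ofR F r) = (0 <= r).
Proof. by rewrite -(rmorph0 (ofR F)) ofR_le. Qed.

Lemma ofR_gt0 r : (0 < ofR F r) = (0 < r).
Proof. by rewrite !lt_def ofR_ge0 fmorph_eq0. Qed.

Lemma ofR_lt : {mono ofR F : x y / x < y}.
Proof. by move=> x y; rewrite -subr_gt0 -rmorphB ofR_gt0 subr_gt0. Qed.

Lemma ofR_real r : ofR F r \is Num.real.
Proof.
by rewrite realE; have [r0|r0] := leP 0 r; rewrite ?ofR_ge0 ?r0//
  -(rmorph0 (ofR F)) ofR_le (ltW r0) orbT.
Qed.

Lemma cj_real z : z \is Num.real -> cj z = z.
Proof.
move=> zr; have [->|z0] := eqVneq z 0; first by rewrite rmorph0.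
by apply: (mulfI z0); rewrite mul_cj real_normK// expr2.
Qed.

Lemma cj_ofR r : cj (ofR F r) = ofR F r.
Proof. by rewrite cj_real// ofR_real. Qed.

Lemma cj_norm (z : F) : cj `|z| = `|z|.
Proof. by rewrite cj_real// normr_real. Qed.

Lemma norm_cj z : `|cj z| = `|z|.
Proof.
have [->|z0] := eqVneq z 0; first by rewrite rmorph0.
have cz0 : cj z != 0 by rewrite fmorph_eq0.
have : `|z * cj z| = `|z| ^+ 2 by rewrite mul_cj normrX normr_id.
by rewrite normrM expr2 => /mulfI; apply; rewrite normr_eq0.
Qed.

Lemma cjK : involutive (@cj R F).
Proof.
move=> z; have [->|z0] := eqVneq z 0; first by rewrite !rmorph0.
have cz0 : cj z != 0 by rewrite fmorph_eq0.
by apply: (mulfI cz0); rewrite mul_cj norm_cj -mul_cj mulrC.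
Qed.

Lemma ofR_re z : z \is Num.real -> ofR F (re z) = z.
Proof.
move=> zr; have := add_cj z; rewrite cj_real// -mulr2n => /eqP.
by rewrite eqrMn2r// => /eqP.
Qed.

Lemma ofRK : cancel (ofR F) re.
Proof. by move=> r; apply: ofR_inj; rewrite ofR_re// ofR_real. Qed.

Lemma reD z1 z2 : re (z1 + z2) = re z1 + re z2 :> R.
Proof.
apply: ofR_inj; rewrite rmorphD; apply: (@mulIf _ (2%:R : F)).
  by rewrite pnatr_eq0.
by rewrite mulrDl !mulr_natr -!add_cj rmorphD addrACA.
Qed.

Lemma reM r z : re (ofR F r * z) = r * re z.
Proof.
apply: ofR_inj; rewrite rmorphM; apply: (@mulIf _ (2%:R : F)).
  by rewrite pnatr_eq0.
by rewrite -mulrA !mulr_natr -!add_cj rmorphM cj_ofR mulrDr.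
Qed.

Lemma re0 : re (0 : F) = 0.
Proof. by rewrite -(rmorph0 (ofR F)) ofRK. Qed.

Lemma reN z : re (- z) = - re z.
Proof. by apply/eqP; rewrite -subr_eq0 opprK -reD addNr re0. Qed.

Lemma reB z1 z2 : re (z1 - z2) = re z1 - re z2.
Proof. by rewrite reD reN. Qed.

Lemma re_cj z : re (cj z) = re z.
Proof.
apply: ofR_inj; apply: (@mulIf _ (2%:R : F)); first by rewrite pnatr_eq0.
by rewrite !mulr_natr -!add_cj cjK addrC.
Qed.

Lemma re_ge0 z : 0 <= z -> 0 <= re z.
Proof. by move=> z0; rewrite -ofR_ge0 ofR_re// ger0_real. Qed.

Lemma re_sum (I : Type) (s : seq I) (P : pred I) (f : I -> F) :
  re (\sum_(i <- s | P i) f i) = \sum_(i <- s | P i) re (f i).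
Proof. exact: (big_morph re reD re0). Qed.

End ScalarTheory.

(* The R-valued norm. *)
Definition nrm (R : realType) (F : scalarField R) (V : normedZmodType F) (x : V) : R :=
  re (`|x| : F).

Section NrmTheory.
Variables (R : realType) (F : scalarField R).

Section NormedZmod.
Variable V : normedZmodType F.
Implicit Types x y : V.

Lemma ofR_nrm x : ofR F (nrm x) = `|x|.
Proof. by rewrite ofR_re// normr_real. Qed.

Lemma nrm_ge0 x : 0 <= nrm x.
Proof. by rewrite -(ofR_ge0 F) ofR_nrm. Qed.

Lemma nrmD x y : nrm (x + y) <= nrm x + nrm y.
Proof. by rewrite -(ofR_le F) rmorphD !ofR_nrm ler_normD. Qed.

Lemma nrm0 : nrm (0 : V) = 0.
Proof. by rewrite /nrm normr0 re0. Qed.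

Lemma nrmN x : nrm (- x) = nrm x.
Proof. by rewrite /nrm normrN. Qed.

Lemma nrmC x y : nrm (x - y) = nrm (y - x).
Proof. by rewrite /nrm distrC. Qed.

Lemma nrm_eq0 x : nrm x = 0 -> x = 0.
Proof.
by move=> x0; apply/eqP; rewrite -normr_eq0 -ofR_nrm x0 rmorph0.
Qed.

Lemma nrm_lt x (r : R) : (`|x| < ofR F r) = (nrm x < r).
Proof. by rewrite -ofR_nrm ofR_lt. Qed.

Lemma nrm_le x (r : R) : (`|x| <= ofR F r) = (nrm x <= r).
Proof. by rewrite -ofR_nrm ofR_le. Qed.

End NormedZmod.

Lemma nrmM (a b : F) : nrm (a * b) = nrm a * nrm b.
Proof. by apply: (@ofR_inj R F); rewrite rmorphM !ofR_nrm normrM. Qed.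

Lemma nrm_ofR (r : R) : nrm (ofR F r) = `|r|.
Proof.
have [r0|/ltW r0] := leP 0 r.
  by rewrite (ger0_norm r0) /nrm ger0_norm ?ofR_ge0// ofRK.
by rewrite (ler0_norm r0) /nrm -normrN -rmorphN ger0_norm ?ofR_ge0 ?oppr_ge0// ofRK.
Qed.

Lemma nrm_cj (a : F) : nrm (cj a) = nrm a.
Proof. by rewrite /nrm norm_cj. Qed.

Lemma nrm_sqr (a : F) : ofR F (nrm a ^+ 2) = a * cj a.
Proof. by rewrite rmorphXn ofR_nrm mul_cj. Qed.

Lemma re_nrm (a : F) : `|re a| <= nrm a.
Proof.
suff H (b : F) : re b <= nrm b.
  by rewrite ler_norml H andbT lerNl -reN -(nrmN a) H.
rewrite -(ofR_le F) ofR_nrm.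
have /real_ler_norm : ofR F (re b) \is Num.real by exact: ofR_real.
move=> /le_trans -> //.
rewrite -(@ler_pM2r _ 2%:R)// mulr_natr -normrMn -add_cj.
by rewrite (le_trans (ler_normD _ _))// norm_cj mulr_natr mulr2n.
Qed.

Lemma nrmZ (V : normedModType F) (a : F) (x : V) : nrm (a *: x) = nrm a * nrm x.
Proof. by apply: (@ofR_inj R F); rewrite rmorphM !ofR_nrm normrZ. Qed.

End NrmTheory.

(* Positive definite sesquilinear forms, conjugate linear on the left. *)
Record ip_axioms (R : realType) (F : scalarField R) (V : lmodType F)
    (f : V -> V -> F) : Prop := IpAxioms {
  ip_cj : forall x y, cj (f x y) = f y x;
  ip_lin : forall a x y z, f x (a *: y + z) = a * f x y + f x z;
  ip_ge0 : forall x, 0 <= f x x;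
  ip_eq0 : forall x, f x x = 0 -> x = 0 }.

Section IpTheory.
Variables (R : realType) (F : scalarField R) (V : lmodType F) (f : V -> V -> F).
Hypothesis fP : ip_axioms f.
Implicit Types (x y : V) (a : F).

Lemma ip0r x : f x 0 = 0.
Proof.
have := ip_lin fP 1 x 0 0; rewrite scale1r addr0 mul1r => /eqP.
by rewrite -subr_eq0 opprD addNKr oppr_eq0 => /eqP.
Qed.

Lemma ip0l x : f 0 x = 0. Proof. by rewrite -(ip_cj fP) ip0r rmorph0. Qed.

Lemma ipDr x y z : f x (y + z) = f x y + f x z.
Proof. by rewrite -[y]scale1r (ip_lin fP) scale1r mul1r. Qed.

Lemma ipZr a x y : f x (a *: y) = a * f x y.
Proof. by rewrite -[_ *: _]addr0 (ip_lin fP) ip0r addr0. Qed.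

Lemma ipNr x y : f x (- y) = - f x y.
Proof. by rewrite -scaleN1r ipZr mulN1r. Qed.

Lemma ipBr x y z : f x (y - z) = f x y - f x z.
Proof. by rewrite ipDr ipNr. Qed.

Lemma ipDl x y z : f (y + z) x = f y x + f z x.
Proof. by rewrite -!(ip_cj fP x) ipDr rmorphD. Qed.

Lemma ipZl a x y : f (a *: y) x = cj a * f y x.
Proof. by rewrite -!(ip_cj fP x) ipZr rmorphM. Qed.

Lemma ipNl x y : f (- y) x = - f y x.
Proof. by rewrite -!(ip_cj fP x) ipNr rmorphN. Qed.

Lemma ipBl x y z : f (y - z) x = f y x - f z x.
Proof. by rewrite ipDl ipNl. Qed.

Lemma ip_sumr (I : Type) (s : seq I) (P : pred I) (g : I -> V) x :
  f x (\sum_(i <- s | P i) g i) = \sum_(i <- s | P i) f x (g i).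
Proof. exact: (big_morph (f x) (ipDr x) (ip0r x)). Qed.

Lemma ip_suml (I : Type) (s : seq I) (P : pred I) (g : I -> V) x :
  f (\sum_(i <- s | P i) g i) x = \sum_(i <- s | P i) f (g i) x.
Proof. exact: (big_morph (f^~ x) (fun y z => ipDl x y z) (ip0l x)). Qed.

Lemma ofR_ip x : ofR F (re (f x x)) = f x x.
Proof. by rewrite ofR_re// ger0_real// (ip_ge0 fP). Qed.

Lemma re_ip_ge0 x : 0 <= re (f x x).
Proof. by rewrite re_ge0// (ip_ge0 fP). Qed.

Lemma ip_CS2 x y : nrm (f x y) ^+ 2 <= re (f x x) * re (f y y).
Proof.
have [y0|y0] := eqVneq y 0; first by rewrite y0 !ip0r re0 mulr0 nrm0 expr0n.
have fy0 : f y y != 0 by apply: contra y0 => /eqP /(ip_eq0 fP) ->.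
have fyp : 0 < f y y by rewrite lt_def fy0 (ip_ge0 fP).
have := ip_ge0 fP (x - (f y x / f y y) *: y).
rewrite ipBl ipZl ipBr ipZr [f y (_ - _)]ipBr ipZr divfK// subrr mulr0 subr0.
rewrite subr_ge0 mulrAC ler_pdivrMr// => H.
by rewrite -(ofR_le F) nrm_sqr (ip_cj fP) rmorphM !ofR_ip mulrC.
Qed.

Lemma ip_CS x y : nrm (f x y) <= Num.sqrt (re (f x x)) * Num.sqrt (re (f y y)).
Proof.
rewrite -sqrtrM ?re_ip_ge0// -(ger0_norm (nrm_ge0 (f x y))) -sqrtr_sqr.
by rewrite ler_wsqrtr// ip_CS2.
Qed.

Lemma ip_sqrD x y : re (f (x + y) (x + y)) =
  re (f x x) + re (f y y) + re (f x y) *+ 2.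
Proof.
rewrite ipDl !ipDr !reD -(ip_cj fP x y) re_cj mulr2n.
by rewrite addrACA [X in _ + X = _]addrC addrACA.
Qed.

Lemma ip_triangle x y : Num.sqrt (re (f (x + y) (x + y))) <=
  Num.sqrt (re (f x x)) + Num.sqrt (re (f y y)).
Proof.
rewrite -ler_sqr ?nnegrE ?addr_ge0 ?sqrtr_ge0// sqrrD !sqr_sqrtr ?re_ip_ge0//.
rewrite ip_sqrD [leRHS]addrAC lerD2l ler_wMn2r//.
by rewrite (le_trans _ (ip_CS x y))// (le_trans _ (re_nrm _))// ler_norm.
Qed.

End IpTheory.

Section Topology.
Variables (R : realType) (F : scalarField R).

Lemma pos_ofR (e : F) : 0 < e -> exists2 r : R, 0 < r & e = ofR F r.
Proof.
move=> e0; have er : e = ofR F (re e) by rewrite ofR_re// gtr0_real.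
by exists (re e); rewrite // -(ofR_gt0 F) -er.
Qed.

Lemma cvg_nrmP (V : normedModType F) (T : Type) (G : set_system T)
    (FG : Filter G) (g : T -> V) (l : V) :
  g @ G --> l <-> forall e : R, 0 < e -> \forall t \near G, nrm (l - g t) < e.
Proof.
split=> [/cvgrPdist_lt gl e e0|H].
  have := gl (ofR F e); rewrite ofR_gt0 => /(_ e0).
  by apply: filterS => t; rewrite nrm_lt.
apply/cvgrPdist_lt => _ /pos_ofR [r r0 ->].
by apply: filterS (H r r0) => t; rewrite nrm_lt.
Qed.

Lemma cauchy_nrmP (V : normedModType F) (G : set_system V) (PG : ProperFilter G) :
  cauchy G <-> forall e : R, 0 < e -> exists x, G [set y | nrm (x - y) < e].
Proof.
split=> [/cauchyP gl e e0|H].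
  have := gl (ofR F e); rewrite ofR_gt0 => /(_ e0)[x Gx]; exists x.
  by apply: filterS Gx => t; rewrite -ball_normE /= nrm_lt.
apply/cauchyP => _ /pos_ofR [r r0 ->].
have [x Gx] := H r r0; exists x.
by apply: filterS Gx => t; rewrite -ball_normE /= nrm_lt.
Qed.

Lemma cvg_nrm_unique (V : normedModType F) (T : Type) (G : set_system T)
    (FG : ProperFilter G) (g : T -> V) (l1 l2 : V) :
  g @ G --> l1 -> g @ G --> l2 -> l1 = l2.
Proof. by move=> h1 h2; apply: (cvg_unique _ h1 h2); exact: norm_hausdorff. Qed.

Lemma scalar_decomp : exists w : F,
  forall z : F, z = ofR F (re z) + w * ofR F (re (z / w)).
Proof.
have two : (2%:R : F) != 0 by rewrite pnatr_eq0.
have [H|] := pselect (forall z : F, cj z = z).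
  exists 0 => z; rewrite mul0r addr0; apply: (mulIf two).
  by rewrite [RHS]mulr_natr -add_cj H mulr_natr mulr2n.
move=> /existsNP[u /eqP u0].
pose w := u - cj u; have w0 : w != 0 by rewrite subr_eq0 eq_sym.
have cw : cj w = - w by rewrite rmorphB cjK opprB.
exists w => z; apply: (mulIf two); rewrite mulrDl -mulrA ![ofR _ _ * _]mulr_natr.
rewrite -!add_cj fmorph_div cw invrN mulrN -mulrBl mulrCA divff// mulr1.
by rewrite addrACA subrr addr0 mulr_natr mulr2n.
Qed.

Lemma scalar_complete (G : set_system F) :
  ProperFilter G -> cauchy G -> cvg G.
Proof.
move=> PG /(@cauchy_nrmP F) cG; have [w wE] := scalar_decomp.
have lim (c : F) : exists a : R, (fun z => re (z * c)) @ G --> a.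
  have PG' : ProperFilter ((fun z => re (z * c)) @ G) by exact: fmap_proper_filter.
  suff /R_complete : cauchy ((fun z => re (z * c)) @ G).
    by move=> /cvg_ex.
  apply/cauchyP => e e0.
  have d0 : 0 < e / (nrm c + 1) by rewrite divr_gt0// ltr_wpDl// nrm_ge0.
  have [x Gx] := cG _ d0; exists (re (x * c)).
  suff: G [set y | `|re (x * c) - re (y * c)| < e] by [].
  apply: filterS Gx => y /= xy.
  rewrite -reB -mulrBl.
  rewrite (le_lt_trans (re_nrm _))// nrmM.
  move: xy; rewrite ltr_pdivlMr; last by rewrite ltr_wpDl// nrm_ge0.
  by apply: le_lt_trans; rewrite ler_wpM2l ?nrm_ge0// lerDl.
have [a Ga] := lim 1; have [b Gb] := lim w^-1.
apply/cvg_ex; exists (ofR F a + w * ofR F b).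
apply/(@cvg_nrmP F _ G _ id) => e e0.
have d0 : 0 < e / 2 / (nrm w + 1).
  by rewrite !divr_gt0// ltr_wpDl// nrm_ge0.
have e20 : 0 < e / 2 by rewrite divr_gt0.
move/cvgrPdist_lt : Ga => /(_ _ e20) Ga.
move/cvgrPdist_lt : Gb => /(_ _ d0) Gb.
near=> z.
rewrite [in ltLHS](wE z) /=.
rewrite opprD addrACA -mulrBr -!rmorphB (le_lt_trans (nrmD _ _))//.
rewrite nrmM !nrm_ofR (splitr e) ltrD//.
  by rewrite -[z]mulr1; near: z.
have : `|b - re (z / w)| < e / 2 / (nrm w + 1) by near: z.
rewrite ltr_pdivlMr; last by rewrite ltr_wpDl// nrm_ge0.
by apply: le_lt_trans; rewrite mulrC ler_wpM2l// lerDl.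
Unshelve. all: by end_near. Qed.

End Topology.

Lemma real_CS (R : realType) (I : Type) (s : seq I) (a b : I -> R) :
  (\sum_(i <- s) a i * b i) ^+ 2 <=
  (\sum_(i <- s) a i ^+ 2) * (\sum_(i <- s) b i ^+ 2).
Proof.
elim: s => [|i s IH]; first by rewrite !big_nil expr0n mulr0.
rewrite !big_cons.
move: IH; set C := \sum_(_ <- _) _; set A := \sum_(_ <- _) _.
set B := \sum_(_ <- _) _ => IH.
have A0 : 0 <= A by apply: sumr_ge0 => j _; exact: sqr_ge0.
have B0 : 0 <= B by apply: sumr_ge0 => j _; exact: sqr_ge0.
set x := a i; set y := b i.
suff : x * y * C *+ 2 <= x ^+ 2 * B + A * y ^+ 2 by nra.
have [h|h] := leP (x * y * C *+ 2) 0.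
  by rewrite (le_trans h)// addr_ge0// mulr_ge0// sqr_ge0.
rewrite -ler_sqr ?nnegrE ?(ltW h)//; last by rewrite addr_ge0// mulr_ge0// sqr_ge0.
have h1 : (x * y * C *+ 2) ^+ 2 = (x * y) ^+ 2 * 4 * C ^+ 2 by ring.
have h2 : (x * y) ^+ 2 * 4 * C ^+ 2 <= (x * y) ^+ 2 * 4 * (A * B).
  by rewrite ler_wpM2l// mulr_ge0// sqr_ge0.
rewrite h1 (le_trans h2)// -subr_ge0.
rewrite (_ : _ - _ = (x ^+ 2 * B - A * y ^+ 2) ^+ 2) ?sqr_ge0//; ring.
Qed.

Section Sums.
Variables (R : realType) (I : choiceType).
Local Open Scope fset_scope.
Implicit Types (A B : {fset I}).

Lemma partial_sumE (V : zmodType) (x : I -> V) A :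
  summability.partial_sum x A = \sum_(i <- A) x i.
Proof. by rewrite /summability.partial_sum big_seq_fsetE. Qed.

Lemma sum_fset_sub (mu : I -> R) A B : (forall i, 0 <= mu i) -> A `<=` B ->
  \sum_(i <- A) mu i <= \sum_(i <- B) mu i.
Proof.
move=> mu0 AB; rewrite (big_fsetID _ [in A] B) /=.
have -> : [fset x in B | x \in A] = A.
  by apply/fsetP => i; rewrite !inE andbC; case: (boolP (i \in A)) => //= /(fsubsetP AB).
by rewrite lerDl sumr_ge0.
Qed.

Lemma sum_fset_diff (V : zmodType) (x : I -> V) A B : A `<=` B ->
  \sum_(i <- B) x i - \sum_(i <- A) x i = \sum_(i <- B `\` A) x i.
Proof.
move=> AB; rewrite (big_fsetID _ [in A] B) /=.
have -> : [fset x in B | x \in A] = A.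
  by apply/fsetP => i; rewrite !inE andbC; case: (boolP (i \in A)) => //= /(fsubsetP AB).
have -> : [fset x in B | x \notin A] = B `\` A.
  by apply/fsetP => i; rewrite !inE andbC.
by rewrite addrAC subrr add0r.
Qed.

Lemma esum_fsetP (mu : I -> R) (M : R) :
  (\esum_(i in [set: I]) (mu i)%:E <= M%:E)%E <->
  (forall A, \sum_(i <- A) mu i <= M).
Proof.
split=> [H A|H].
  rewrite -lee_fin (le_trans _ H)//; apply: ereal_sup_ubound.
  exists [set` A]; first by split.
  by rewrite fsbig_finite//= set_fsetK sumEFin.
apply: ge_ereal_sup => _ [A [fA _] <-].
by rewrite fsbig_finite// sumEFin lee_fin.
Qed.

Lemma esum_lty (mu : I -> R) : (forall i, 0 <= mu i) ->
  (\esum_(i in [set: I]) (mu i)%:E < +oo)%E <->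
  (exists M, forall A, \sum_(i <- A) mu i <= M).
Proof.
move=> mu0; split=> [H|[M /esum_fsetP H]]; last first.
  by rewrite (le_lt_trans H)// ltry.
exists (fine (\esum_(i in [set: I]) (mu i)%:E)); apply/esum_fsetP.
by rewrite fineK// ge0_fin_numE// esum_ge0// => i _; rewrite lee_fin.
Qed.

Lemma sum_tail (mu : I -> R) (M : R) : (forall i, 0 <= mu i) ->
  (forall A, \sum_(i <- A) mu i <= M) ->
  forall e, 0 < e -> exists A, forall B, A `<=` B ->
    \sum_(i <- B `\` A) mu i < e.
Proof.
move=> mu0 Mub e e0.
pose S := [set \sum_(i <- A) mu i | A in [set: {fset I}]].
have hS : has_sup S.
  split; first by exists (\sum_(i <- fset0) mu i), fset0.
  by exists M => _ [A _ <-].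
have [_ [A _ <-] HA] := sup_adherent e0 hS.
exists A => B AB; rewrite -sum_fset_diff// ltrBlDl -ltrBlDr.
rewrite (le_lt_trans _ HA)// lerB// sup_upper_bound//; by exists B.
Qed.

End Sums.

#[global] Instance totallyP (I : choiceType) : ProperFilter (@summability.totally I) :=
  summability.totally_filter.

Section Totally.
Variables (R : realType) (F : scalarField R) (I : choiceType).
Local Open Scope fset_scope.

Lemma near_totally (P : set {fset I}) (A : {fset I}) :
  (forall B, A `<=` B -> P B) -> \forall B \near summability.totally, P B.
Proof. by move=> H; exists A. Qed.

Lemma cauchy_totally (V : normedModType F) (g : {fset I} -> V) :
  (forall e : R, 0 < e -> exists A, forall B, A `<=` B -> nrm (g A - g B) < e) ->
  cauchy (g @ summability.totally).
Proof.
move=> H; apply/cauchy_nrmP => e /H [A HA]; exists (g A).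
exact: near_totally HA.
Qed.

Lemma scalar_sum_cvg (x : I -> F) (M : R) :
  (forall A : {fset I}, \sum_(i <- A) nrm (x i) <= M) ->
  cvg (summability.partial_sum x @ summability.totally).
Proof.
move=> xM; apply: scalar_complete; apply: cauchy_totally => e e0.
have [i|A HA] := sum_tail _ xM e0; first exact: nrm_ge0.
exists A => B AB; rewrite !partial_sumE nrmC sum_fset_diff//.
rewrite (le_lt_trans _ (HA B AB))//; elim/big_ind2 : _ => //.
  by rewrite nrm0.
by move=> x1 x2 y1 y2 h1 h2; rewrite (le_trans (nrmD _ _))// lerD.
Qed.

End Totally.

(* Hilbert spaces; the inner product is conjugate linear on the left and linear
   on the right, as forced by <U1, U2> = trace (U1^* U2) below. *)
HB.mixin Record isHilbert (R : realType) (F : scalarField R) V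
    of CompleteNormedModule F V := {
  inner : V -> V -> F;
  inner_cj : forall x y, cj (inner x y) = inner y x;
  inner_lin : forall a x y z, inner x (a *: y + z) = a * inner x y + inner x z;
  inner_norm : forall x, inner x x = `|x| ^+ 2
}.

#[short(type="hilbertType")]
HB.structure Definition Hilbert (R : realType) (F : scalarField R) :=
  {V of CompleteNormedModule F V & isHilbert R F V}.

Section Subspaces.
Variables (R : realType) (F : scalarField R) (H : hilbertType F).

Definition closed_subspace (U : set H) :=
  [/\ U 0, forall x y, U x -> U y -> U (x + y),
      forall (a : F) x, U x -> U (a *: x) & closed U].

Definition orthonormal (E : set H) :=
  forall e e', E e -> E e' -> inner e e' = (e == e')%:R.

Definition is_onb (E : set H) :=
  orthonormal E /\ forall x, (forall e, E e -> inner e x = 0) -> x = 0.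

(* A fixed orthonormal basis; it exists by onbP. *)
Definition onb : set H := xget set0 is_onb.

(* The orthogonal projection onto U, see projP for closed subspaces. *)
Definition proj (U : set H) (x : H) : H :=
  xget 0 [set p | U p /\ forall u, U u -> inner u (x - p) = 0].

End Subspaces.
Arguments onb {R F} H.

Section HilbertTheory.
Variables (R : realType) (F : scalarField R) (H : hilbertType F).
Implicit Types (x y : H) (U E : set H).

Lemma inner_ip : ip_axioms (@inner R F H).
Proof.
split; [exact: inner_cj|exact: inner_lin|by move=> x; rewrite inner_norm exprn_ge0|].
by move=> x /eqP; rewrite inner_norm expf_eq0 /= normr_eq0 => /eqP.
Qed.
Let ipP := inner_ip.

Lemma innerE x : inner x x = ofR F (nrm x ^+ 2).
Proof. by rewrite rmorphXn ofR_nrm inner_norm. Qed.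

Lemma re_inner x : re (inner x x) = nrm x ^+ 2.
Proof. by rewrite innerE ofRK. Qed.

Lemma inner_CS x y : nrm (inner x y) <= nrm x * nrm y.
Proof.
by have := ip_CS ipP x y; rewrite !re_inner !sqrtr_sqr !ger0_norm ?nrm_ge0.
Qed.

Lemma inner_cvg (T : Type) (G : set_system T) (FG : Filter G) (g : T -> H)
    (l y : H) : g @ G --> l -> inner y (g t) @[t --> G] --> inner y l.
Proof.
move=> /cvg_nrmP gl; apply/cvg_nrmP => e e0.
have d0 : 0 < e / (nrm y + 1) by rewrite divr_gt0// ltr_wpDl// nrm_ge0.
apply: filterS (gl _ d0) => t.
rewrite ltr_pdivlMr; last by rewrite ltr_wpDl// nrm_ge0.
apply: le_lt_trans; rewrite -(ipBr ipP) (le_trans (inner_CS _ _))//.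
by rewrite mulrC ler_wpM2l ?nrm_ge0// lerDl.
Qed.

Lemma onb_exists_in U : U 0 -> (forall (a : F) x, U x -> U (a *: x)) ->
  exists E, [/\ E `<=` U, orthonormal E &
    forall x, U x -> (forall e, E e -> inner e x = 0) -> x = 0].
Proof.
move=> U0 UZ; pose P E := E `<=` U /\ orthonormal E.
have [|E [[EU Eo] Emax]] := @Zorn_bigcup H P.
  move=> G GP Gtot; split; first by apply: bigcup_sub => X /GP [].
  move=> e e' [X GX Xe] [Y GY Ye']; have [XY|YX] := Gtot _ _ GX GY.
    by have [_] := GP _ GY; apply => //; exact: XY.
  by have [_] := GP _ GX; apply => //; exact: YX.
exists E; split => // x Ux Ex; apply: contrapT => /eqP x0.
have nx0 : (`|x| : F) != 0 by rewrite normr_eq0.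
pose u : H := (`|x|^-1 : F) *: x.
have Eu e : E e -> inner e u = 0 by move=> Ee; rewrite (ipZr ipP) Ex// mulr0.
have uu : inner u u = 1.
  rewrite inner_norm /u normrZ normfV normr_id mulVf// expr1n//.
have nEu : ~ E u by move=> /Eu; rewrite uu => /eqP; rewrite oner_eq0.
apply: (Emax (E `|` [set u])).
  split; first by move=> e Ee; left.
  by move=> h; apply: nEu; apply: h; right.
split; first by move=> e [/EU//|->]; exact: UZ.
move=> e e' [Ee|->] [Ee'|->].
- exact: Eo.
- rewrite Eu//; case: eqP => // eu; case: nEu; by rewrite -eu.
- rewrite -inner_cj Eu// rmorph0; case: eqP => // eu; case: nEu; by rewrite eu.
- by rewrite eqxx.
Qed.

Lemma onbP : is_onb (onb H).
Proof.
have [E [_ Eo Ec]] := @onb_exists_in setT I (fun _ _ _ => I).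
by apply: (@xgetPex _ set0); exists E; split=> // x; exact: Ec.
Qed.

Section Fourier.
Variables (I : choiceType) (e : I -> H).
Hypothesis eo : forall i j, inner (e i) (e j) = (i == j)%:R.
Implicit Types (c : I -> F) (A : {fset I}) (i : I).

Definition fsum c A : H := \sum_(i <- A) c i *: e i.

Lemma inner_fsum c A i : i \in A -> inner (e i) (fsum c A) = c i.
Proof.
move=> iA; rewrite (ip_sumr ipP) (big_rem i)//= (ipZr ipP) eo eqxx mulr1.
rewrite big_seq big1 ?addr0// => j; rewrite (rem_filter _ (fset_uniq A)).
rewrite mem_filter /= => /andP[ji _]; rewrite (ipZr ipP) eo eq_sym.
by rewrite (negbTE ji) mulr0.
Qed.

Lemma nrm_fsum c A : nrm (fsum c A) ^+ 2 = \sum_(i <- A) nrm (c i) ^+ 2.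
Proof.
apply: (@ofR_inj R F); rewrite -innerE {1}/fsum [X in inner X _]big_seq.
rewrite (ip_suml ipP) -big_seq rmorph_sum big_seq [RHS]big_seq.
by apply: eq_bigr => i iA; rewrite (ipZl ipP) inner_fsum// nrm_sqr mulrC.
Qed.

Lemma fsumB c A B : (A `<=` B)%fset -> fsum c B - fsum c A = fsum c (B `\` A)%fset.
Proof. exact: sum_fset_diff. Qed.

Lemma bessel_ineq x A : \sum_(i <- A) nrm (inner (e i) x) ^+ 2 <= nrm x ^+ 2.
Proof.
pose c i := inner (e i) x; pose s := fsum c A.
have sx : inner s x = ofR F (nrm s ^+ 2).
  rewrite nrm_fsum rmorph_sum /s (ip_suml ipP); apply: eq_bigr => i _.
  by rewrite (ipZl ipP) nrm_sqr mulrC.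
rewrite -(nrm_fsum c A) -/s -subr_ge0.
rewrite (_ : _ - _ = nrm (x - s) ^+ 2) ?sqr_ge0//.
rewrite -!re_inner !(ipBl ipP) !(ipBr ipP) sx -(inner_cj s x) sx cj_ofR.
by rewrite (innerE s) subrr subr0 reB ofRK.
Qed.

Lemma fsum_cvg c (M : R) : (forall A, \sum_(i <- A) nrm (c i) ^+ 2 <= M) ->
  cvg (fsum c @ summability.totally).
Proof.
move=> cM; apply: cauchy_cvg; apply: cauchy_totally => d d0.
have d20 : 0 < d ^+ 2 by rewrite exprn_gt0.
have [i|A HA] := sum_tail _ cM d20; first exact: sqr_ge0.
exists A => B AB; rewrite nrmC fsumB//.
by rewrite -ltr_sqr ?nnegrE ?nrm_ge0 ?(ltW d0)// nrm_fsum HA.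
Qed.

Definition fcoef x i : F := inner (e i) x.

Definition fourier x : H := lim (fsum (fcoef x) @ summability.totally).

Lemma fourier_cvg x : fsum (fcoef x) @ summability.totally --> fourier x.
Proof. exact: (fsum_cvg (bessel_ineq x)). Qed.

Lemma inner_fsum_cvg c (l : H) i :
  fsum c @ summability.totally --> l -> inner (e i) l = c i.
Proof.
move=> cl; apply: (@cvg_nrm_unique R F F _ (@summability.totally I) _
  (fun A => inner (e i) (fsum c A))).
  exact: inner_cvg.
apply/cvg_nrmP => d d0; apply: (@near_totally _ _ [fset i]%fset) => B.
by rewrite fsub1set => iB /=; rewrite inner_fsum// subrr nrm0.
Qed.

Lemma inner_fourier x i : inner (e i) (fourier x) = inner (e i) x.
Proof. exact: inner_fsum_cvg (@fourier_cvg x). Qed.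

Lemma fsum_in U A c : closed_subspace U -> (forall i, U (e i)) -> U (fsum c A).
Proof.
move=> [U0 UD UZ _] EU; rewrite /fsum; elim/big_ind : _ => // i _.
exact: UZ.
Qed.

Lemma fourier_in U x : closed_subspace U -> (forall i, U (e i)) -> U (fourier x).
Proof.
move=> cU EU; have [_ _ _ clU] := cU.
apply: (closed_cvg _ clU _ _ (@fourier_cvg x)).
by apply: nearW => A; exact: fsum_in.
Qed.

Lemma fourier_id U x : closed_subspace U -> (forall i, U (e i)) ->
  (forall x, U x -> (forall i, inner (e i) x = 0) -> x = 0) ->
  U x -> fourier x = x.
Proof.
move=> cU EU Ec Ux; apply/eqP; rewrite -subr_eq0; apply/eqP.
have [U0 UD UZ _] := cU; apply: Ec.
  by apply: UD; [exact: fourier_in|rewrite -scaleN1r; exact: UZ].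
by move=> i; rewrite (ipBr ipP) inner_fourier subrr.
Qed.

End Fourier.

Definition elt E (i : E) : H := val i.

Lemma eltP E (i : E) : E (elt i).
Proof. by apply: set_mem; exact: valP. Qed.

Lemma elt_orthonormal E : orthonormal E ->
  forall i j : E, inner (elt i) (elt j) = (i == j)%:R.
Proof. by move=> Eo i j; rewrite Eo//; exact: eltP. Qed.

Lemma onb_orthonormal (i j : onb H) : inner (elt i) (elt j) = (i == j)%:R.
Proof. by apply: elt_orthonormal; case: onbP. Qed.

Lemma onb_complete x : (forall i : onb H, inner (elt i) x = 0) -> x = 0.
Proof.
move=> h; have [_] := onbP; apply => e eE.
exact: (h (SigSub (mem_set eE))).
Qed.

Lemma closed_subspaceT : closed_subspace [set: H].
Proof. by split => //; exact: closedT. Qed.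

Lemma onb_cvg x :
  fsum (@elt (onb H)) (fcoef (@elt (onb H)) x) @ summability.totally --> x.
Proof.
have {2}<- : fourier (@elt (onb H)) x = x.
  apply: (fourier_id onb_orthonormal closed_subspaceT) => // y _.
  exact: onb_complete.
exact: fourier_cvg onb_orthonormal x.
Qed.

Lemma projP U x : closed_subspace U ->
  U (proj U x) /\ forall u, U u -> inner u (x - proj U x) = 0.
Proof.
move=> cU; have [U0 UD UZ _] := cU.
apply: (@xgetPex _ 0 [set p | U p /\ forall u, U u -> inner u (x - p) = 0]).
have [E [EU Eo Ec]] := onb_exists_in U0 UZ.
have eo := elt_orthonormal Eo.
have eU (i : E) : U (elt i) by apply: EU; exact: eltP.
pose p := fourier (@elt E) x; exists p; split; first exact: fourier_in.
move=> u Uu.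
have := @inner_cvg _ _ _ _ _ (x - p) (@fourier_cvg _ _ eo u).
have -> : fourier (@elt E) u = u.
  apply: (fourier_id eo cU eU _ Uu) => y Uy h; apply: Ec => // e eE.
  exact: (h (SigSub (mem_set eE))).
move=> ul; rewrite -inner_cj (_ : inner _ u = 0) ?rmorph0//.
apply: (cvg_nrm_unique _ (ul _)).
apply/cvg_nrmP => d d0; apply: nearW => A.
rewrite (ip_sumr ipP) big1 ?subrr ?nrm0// => i _.
rewrite (ipZr ipP) -(inner_cj (elt i)) (ipBr ipP) (inner_fourier eo) subrr.
by rewrite rmorph0 mulr0.
Qed.

End HilbertTheory.

Section Operators.
Variables (R : realType) (F : scalarField R) (H : hilbertType F).
Implicit Types T : H -> H.

Definition bounded_op T := linear T /\ continuous T.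

(* The adjoint, see adjP for bounded operators. *)
Definition adj T (y : H) : H :=
  xget 0 [set z | forall x, inner z x = inner y (T x)].

(* Unconditional sum (limit over finite subsets) of the diagonal coefficients in
   the basis onb; on trace class operators the basis is immaterial. *)
Definition trace T : F :=
  summability.sum (fun e : onb H => inner (elt e) (T (elt e)) : F).

(* Here also, the condition does not depend on the basis. *)
Definition hilbert_schmidt T :=
  bounded_op T /\
  (\esum_(e in [set: onb H]) (nrm (T (elt e)) ^+ 2)%:E < +oo)%E.

End Operators.

Section OperatorTheory.
Variables (R : realType) (F : scalarField R) (H : hilbertType F).
Implicit Types T : H -> H.

Lemma bdd_cvg (V : normedModType F) (T : H -> V) (M : R) (X : Type)
    (G : set_system X) (FG : Filter G) (g : X -> H) (l : H) :
  (forall x y, T (x - y) = T x - T y) -> (forall x, nrm (T x) <= M * nrm x) ->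
  g @ G --> l -> T (g t) @[t --> G] --> T l.
Proof.
move=> TB TM /cvg_nrmP gl; apply/cvg_nrmP => e e0.
have M0 : 0 < `|M| + 1 by rewrite ltr_wpDl.
have d0 : 0 < e / (`|M| + 1) by rewrite divr_gt0.
apply: filterS (gl _ d0) => t; rewrite ltr_pdivlMr//.
apply: le_lt_trans; rewrite -TB (le_trans (TM _))// mulrC ler_wpM2l ?nrm_ge0//.
by rewrite (le_trans (ler_norm _))// lerDl.
Qed.

Lemma linear_sub T : linear T -> forall x y, T (x - y) = T x - T y.
Proof.
by move=> Tl x y; rewrite addrC -scaleN1r Tl scaleN1r addrC.
Qed.

Lemma linear_0 T : linear T -> T 0 = 0.
Proof. by move=> /linear_sub /(_ 0 0); rewrite !subrr. Qed.

Lemma linear_fsum T (I : choiceType) (e : I -> H) (c : I -> F) A :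
  linear T -> T (fsum e c A) = \sum_(i <- A) c i *: T (e i).
Proof.
move=> Tl; rewrite /fsum; elim/big_rec2 : _ => [|i y x _ <-]; first exact: linear_0.
by rewrite Tl.
Qed.

Lemma boundedP T : bounded_op T ->
  exists2 M : R, 0 <= M & forall x, nrm (T x) <= M * nrm x.
Proof.
move=> [Tl Tc]; have : T t @[t --> (0 : H)] --> T 0 by exact: Tc.
rewrite linear_0// => /(@cvg_nrmP R F) /(_ 1 ltr01).
rewrite nearE -nbhs_ballE => -[_ /= /pos_ofR[r r0 ->] Hr].
have r20 : 0 < r / 2 by rewrite divr_gt0.
exists (r / 2)^-1; first by rewrite invr_ge0 ltW.
move=> x; have [->|x0] := eqVneq x 0; first by rewrite linear_0// !nrm0 mulr0.
have nx : 0 < nrm x.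
  by rewrite lt_def nrm_ge0 andbT; apply: contra x0 => /eqP /nrm_eq0 ->.
pose a := r / 2 / nrm x; have a0 : 0 < a by rewrite divr_gt0.
have /Hr /= : ball (0 : H) (ofR F r) (ofR F a *: x).
  rewrite -ball_normE /= nrm_lt sub0r nrmN nrmZ nrm_ofR gtr0_norm// /a.
  by rewrite divfK ?gt_eqF// ltr_pdivrMr// ltr_pMr// ltr1n.
rewrite sub0r nrmN.
have -> : T (ofR F a *: x) = ofR F a *: T x.
  by have := Tl (ofR F a) x 0; rewrite (linear_0 Tl) !addr0.
rewrite nrmZ nrm_ofR gtr0_norm// => /ltW h.
have -> : (r / 2)^-1 * nrm x = a^-1 by rewrite /a [RHS]invfM invrK.
by rewrite -(ler_pM2l a0) mulfV// gt_eqF.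
Qed.

Lemma bounded_opI T (M : R) : linear T -> (forall x, nrm (T x) <= M * nrm x) ->
  bounded_op T.
Proof.
by move=> Tl TM; split=> // x; apply: bdd_cvg TM _ => //; exact: linear_sub.
Qed.

Lemma riesz (phi : H -> F) (M : R) :
  (forall a x y, phi (a *: x + y) = a * phi x + phi y) ->
  (forall x, nrm (phi x) <= M * nrm x) ->
  exists z, forall x, inner z x = phi x.
Proof.
move=> phil phiM.
have phiB x y : phi (x - y) = phi x - phi y.
  by rewrite addrC -scaleN1r phil mulN1r addrC.
have phi0 : phi 0 = 0 by have := phiB 0 0; rewrite !subrr.
pose e := @elt _ _ H (onb H); have eo := @onb_orthonormal _ _ H.
have phi_fsum c A : phi (fsum e c A) = \sum_(i <- A) c i * phi (e i).
  by rewrite /fsum; elim/big_rec2 : _ => // i y x _ <-; rewrite phil.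
pose c i := cj (phi (e i)).
have cM (A : {fset onb H}) : \sum_(i <- A) nrm (c i) ^+ 2 <= M ^+ 2.
  have := phiM (fsum e c A); rewrite phi_fsum.
  have -> : \sum_(i <- A) c i * phi (e i) = ofR F (nrm (fsum e c A) ^+ 2).
    rewrite (nrm_fsum eo) rmorph_sum; apply: eq_bigr => i _.
    by rewrite nrm_sqr /c cjK.
  rewrite -(nrm_fsum eo) nrm_ofR ger0_norm ?sqr_ge0//.
  have := nrm_ge0 (fsum e c A); set s := nrm _.
  rewrite le_eqVlt => /predU1P[<- _|s0]; first by rewrite expr0n sqr_ge0.
  rewrite expr2 ler_pM2r// => sM; rewrite ler_sqr ?nnegrE ?(ltW s0)//.
  exact: le_trans (ltW s0) sM.
have /cvg_ex[z zc] := fsum_cvg eo cM.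
have ze i : inner z (e i) = phi (e i).
  by rewrite -inner_cj (inner_fsum_cvg eo _ zc) cjK.
exists z => x.
have h1 := @inner_cvg _ _ _ _ _ _ _ _ z (@onb_cvg _ _ H x).
have h2 := @bdd_cvg F phi M _ _ _ _ _ phiB phiM (@onb_cvg _ _ H x).
apply: (cvg_nrm_unique _ (h1 _)).
rewrite (_ : (fun t => _) = (fun A => phi (fsum e (fcoef e x) A))); last first.
  apply/funext => A; rewrite phi_fsum (ip_sumr (inner_ip H)).
  by apply: eq_bigr => i _; rewrite (ipZr (inner_ip H)) ze.
exact: h2.
Qed.

Lemma adjP T y x : bounded_op T -> inner (adj T y) x = inner y (T x).
Proof.
move=> bT; have [M M0 TM] := boundedP bT; have [Tl _] := bT.
have [z zP] : exists z, forall x, inner z x = inner y (T x).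
  apply: (@riesz _ (nrm y * M)).
    by move=> a u v; rewrite Tl inner_lin.
  move=> u; rewrite (le_trans (inner_CS _ _))// -mulrA.
  by rewrite ler_wpM2l// nrm_ge0.
exact: (@xgetPex _ 0 [set z | forall x, inner z x = inner y (T x)]
  (ex_intro _ z zP)).
Qed.

Lemma hsP T : hilbert_schmidt T <-> bounded_op T /\
  exists M : R, forall A : {fset onb H}, \sum_(i <- A) nrm (T (elt i)) ^+ 2 <= M.
Proof.
by split=> -[bT] /esum_lty h; split=> //; apply: h => i; exact: sqr_ge0.
Qed.

Lemma hs_lin (a : F) T S : hilbert_schmidt T -> hilbert_schmidt S ->
  hilbert_schmidt (a *: T + S).
Proof.
move=> /hsP[bT [M TM]] /hsP[bS [N SN]]; apply/hsP; split.
  have [P P0 HP] := boundedP bT; have [Q Q0 HQ] := boundedP bS.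
  apply: (@bounded_opI _ (nrm a * P + Q)).
    have [Tl _] := bT; have [Sl _] := bS => b x y /=.
    rewrite !fctE Tl Sl !scalerDr !scalerA mulrC [in RHS]addrA.
    rewrite -!scalerA -!addrA; congr (_ + _); rewrite addrCA; congr (_ + _).
  move=> x; rewrite !fctE (le_trans (nrmD _ _))// mulrDl lerD// nrmZ -mulrA.
  by rewrite ler_wpM2l// nrm_ge0.
exists (2 * (nrm a ^+ 2 * M + N)) => A.
apply: (@le_trans _ _ (\sum_(i <- A)
    2 * (nrm a ^+ 2 * nrm (T (elt i)) ^+ 2 + nrm (S (elt i)) ^+ 2))).
  apply: ler_sum => i _; rewrite !fctE.
  have := nrmD (a *: T (elt i)) (S (elt i)); rewrite nrmZ.
  move: (nrm_ge0 (a *: T (elt i) + S (elt i))); set u := nrm _.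
  set v := nrm _ * nrm _; set w := nrm _ => u0 uvw.
  have := sqr_ge0 (v - w); rewrite -exprMn -/v; nra.
rewrite -mulr_sumr ler_wpM2l// big_split /= -mulr_sumr lerD// ler_wpM2l//.
exact: sqr_ge0.
Qed.

Lemma hs_0 : hilbert_schmidt (0 : H -> H).
Proof.
have E0 x : (0 : H -> H) x = 0 by [].
apply/hsP; split.
  apply: (@bounded_opI _ 0) => [a x y|x]; first by rewrite !E0 scaler0 addr0.
  by rewrite E0 nrm0 mul0r.
by exists 0 => A; rewrite big1// => i _; rewrite E0 nrm0 expr0n.
Qed.

End OperatorTheory.

Definition hs_pred (R : realType) (F : scalarField R) (H : hilbertType F) :
  {pred H -> H} := fun T => `[< hilbert_schmidt T >].

(* The Hilbert space of Hilbert-Schmidt operators on H; its norm and inner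
   product are S2_norm and S2_inner below. *)
Record S2 (R : realType) (F : scalarField R) (H : hilbertType F) := S2_of {
  S2_op :> H -> H;
  _ : S2_op \in @hs_pred R F H }.

Section S2_lmodule.
Variables (R : realType) (F : scalarField R) (H : hilbertType F).

Lemma hs_pred_submod : submod_closed (@hs_pred R F H).
Proof.
split=> [|a T S]; first by apply/asboolP; exact: hs_0.
by move=> /asboolP hT /asboolP hS; apply/asboolP; exact: hs_lin.
Qed.

HB.instance Definition _ :=
  GRing.isSubmodClosed.Build F (H -> H) (@hs_pred R F H) hs_pred_submod.
HB.instance Definition _ := [isSub for @S2_op R F H].
HB.instance Definition _ := [Choice of S2 H by <:].
HB.instance Definition _ := [SubChoice_isSubLmodule of S2 H by <:].

End S2_lmodule.

Section Limits.
Variables (R : realType) (F : scalarField R).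
Context (T : Type) (G : set_system T) {FG : Filter G}.

Lemma cj_cvg (g : T -> F) l : g @ G --> l -> cj (g t) @[t --> G] --> cj l.
Proof.
move=> /(@cvg_nrmP R F) gl; apply/cvg_nrmP => e /gl.
by apply: filterS => t; rewrite -rmorphB nrm_cj.
Qed.

Lemma re_cvg (g : T -> F) l : g @ G --> l -> re (g t) @[t --> G] --> re l.
Proof.
move=> /(@cvg_nrmP R F) gl; apply/cvgrPdist_lt => e /gl.
by apply: filterS => t; rewrite -reB; apply: le_lt_trans (re_nrm _).
Qed.

Lemma nrm_cvg (V : normedModType F) (g : T -> V) l :
  g @ G --> l -> nrm (g t) @[t --> G] --> nrm l.
Proof.
move=> /(@cvg_nrmP R F) gl; apply/cvgrPdist_lt => e /gl.
apply: filterS => t; apply: le_lt_trans.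
have h (x y : V) : nrm x - nrm y <= nrm (x - y).
  by rewrite lerBlDr (le_trans _ (nrmD _ _))// subrK.
by rewrite ler_norml h andbT lerNl opprB nrmC h.
Qed.

Lemma lin_cvg (a : F) (g h : T -> F) l m : g @ G --> l -> h @ G --> m ->
  a * g t + h t @[t --> G] --> a * l + m.
Proof. by move=> gl hm; apply: cvgD hm; apply: cvgM gl; exact: cvg_cst. Qed.

Lemma sum_sqr_cvg (I : Type) (s : seq I) (g : I -> T -> R) (l : I -> R) :
  (forall i, g i @ G --> l i) ->
  \sum_(i <- s) g i t ^+ 2 @[t --> G] --> \sum_(i <- s) l i ^+ 2.
Proof.
move=> gl; elim: s => [|i s IH].
  by rewrite big_nil; under eq_fun do rewrite big_nil; exact: cvg_cst.
rewrite big_cons; under eq_fun do rewrite big_cons.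
by apply: cvgD => //; rewrite expr2; under eq_fun do rewrite expr2; exact: cvgM.
Qed.

End Limits.

Section S2_inner.
Variables (R : realType) (F : scalarField R) (H : hilbertType F).
Implicit Types T U V : S2 H.
Local Notation e := (@elt _ _ H (onb H)).

Definition S2_inner U V : F := trace (adj U \o V).

Lemma S2P U : hilbert_schmidt U.
Proof. by case: U => U /= /asboolP. Qed.

Lemma S2E (a : F) U V x : (a *: U + V) x = a *: U x + V x. Proof. by []. Qed.

Lemma S2_ext U V : (forall x, U x = V x) -> U = V.
Proof. by move=> UV; apply: val_inj; exact/funext. Qed.

Let ips U V (A : {fset onb H}) : F := \sum_(i <- A) inner (U (e i)) (V (e i)).
Let sqs U (A : {fset onb H}) : R := \sum_(i <- A) nrm (U (e i)) ^+ 2.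

Lemma S2_cvg U V : ips U V @ @summability.totally (onb H) --> S2_inner U V.
Proof.
have [bU [M UM]] := (hsP U).1 (S2P U); have [bV [N VN]] := (hsP V).1 (S2P V).
pose x (i : onb H) : F := inner (e i) ((adj U \o V) (e i)).
have xE i : x i = inner (U (e i)) (V (e i)).
  by rewrite /x /= -inner_cj adjP// inner_cj.
have : cvg (summability.partial_sum x @ summability.totally).
  apply: (@scalar_sum_cvg _ _ _ _ (M + N)) => A.
  apply: le_trans (lerD (UM A) (VN A)); rewrite -big_split /=.
  apply: ler_sum => i _; rewrite xE (le_trans (inner_CS _ _))//.
  have := nrm_ge0 (U (e i)); have := nrm_ge0 (V (e i)); nra.
have -> : ips U V = summability.partial_sum x.
  by apply/funext => A; rewrite partial_sumE; apply: eq_bigr => i _; rewrite xE.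
exact.
Qed.

Arguments S2_cvg U V : clear implicits.

Lemma S2_cvg_diag U : sqs U @ @summability.totally (onb H) --> re (S2_inner U U).
Proof.
have -> : sqs U = (fun A => re (ips U U A)).
  by apply/funext => A; rewrite re_sum; apply: eq_bigr => i _; rewrite re_inner.
exact: re_cvg (S2_cvg U U).
Qed.

Arguments S2_cvg_diag U : clear implicits.

Lemma S2_inner_cj U V : cj (S2_inner U V) = S2_inner V U.
Proof.
apply: (cvg_nrm_unique _ (cj_cvg (S2_cvg U V))).
have -> : (fun A => cj (ips U V A)) = ips V U; last exact: S2_cvg.
by apply/funext => A; rewrite rmorph_sum; apply: eq_bigr => i _; rewrite inner_cj.
Qed.

Lemma S2_inner_lin (a : F) U V T :
  S2_inner U (a *: V + T) = a * S2_inner U V + S2_inner U T.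
Proof.
apply: (cvg_nrm_unique _ (S2_cvg _ _)).
have -> : ips U (a *: V + T) = (fun A => a * ips U V A + ips U T A).
  apply/funext => A; rewrite mulr_sumr -big_split; apply: eq_bigr => i _.
  by rewrite S2E inner_lin.
by apply: lin_cvg; exact: S2_cvg.
Qed.

Lemma S2_partial_le U (A : {fset onb H}) : \sum_(i <- A) nrm (U (e i)) ^+ 2 <= re (S2_inner U U).
Proof.
apply: (closed_cvg _ (@closed_ge R _) _ _ (S2_cvg_diag U)).
by apply: (@near_totally _ _ A) => B AB; apply: sum_fset_sub => // i; exact: sqr_ge0.
Qed.

Lemma S2_le_partial U (M : R) :
  (forall A : {fset onb H}, \sum_(i <- A) nrm (U (e i)) ^+ 2 <= M) -> re (S2_inner U U) <= M.
Proof.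
move=> UM; apply: (closed_cvg _ (@closed_le R _) _ _ (S2_cvg_diag U)).
by apply: nearW => A; exact: UM.
Qed.

Lemma S2_op_le U (M : R) x : 0 <= M ->
  (forall A : {fset onb H}, \sum_(i <- A) nrm (U (e i)) ^+ 2 <= M ^+ 2) ->
  nrm (U x) <= M * nrm x.
Proof.
move=> M0 UM; have [bU _] := S2P U; have [K K0 UK] := boundedP bU.
have [Ul _] := bU.
have h := @bdd_cvg _ _ _ H U K _ _ _ _ _ (linear_sub Ul) UK (@onb_cvg _ _ H x).
apply: (closed_cvg _ (@closed_le R _) _ _ (nrm_cvg (h _))).
apply: nearW => A /=; rewrite (linear_fsum e _ _ Ul).
apply: (@le_trans _ _ (\sum_(i <- A) nrm (U (e i)) * nrm (inner (e i) x))).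
  elim/big_ind2 : _ => [|x1 x2 y1 y2 h1 h2|i _]; first by rewrite nrm0.
    by rewrite (le_trans (nrmD _ _))// lerD.
  by rewrite nrmZ mulrC.
have s0 : 0 <= \sum_(i <- A) nrm (U (e i)) * nrm (inner (e i) x).
  by apply: sumr_ge0 => i _; rewrite mulr_ge0// nrm_ge0.
rewrite -ler_sqr ?nnegrE ?mulr_ge0 ?nrm_ge0//.
apply: le_trans (real_CS _ _ _) _; rewrite exprMn ler_pM//.
- by apply: sumr_ge0 => i _; exact: sqr_ge0.
- by apply: sumr_ge0 => i _; exact: sqr_ge0.
- exact: (bessel_ineq (@onb_orthonormal _ _ H)).
Qed.

Lemma S2_inner_real U : S2_inner U U \is Num.real.
Proof.
have := add_cj (S2_inner U U); rewrite S2_inner_cj -mulr2n => /eqP.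
by rewrite eqrMn2r// => /eqP ->; exact: ofR_real.
Qed.

Lemma S2_ip : ip_axioms S2_inner.
Proof.
split; [exact: S2_inner_cj|exact: S2_inner_lin| |].
  move=> U; rewrite -(ofR_re (S2_inner_real U)) ofR_ge0.
  by have := S2_partial_le U fset0; rewrite big_seq_fset0.
move=> U U0; apply: S2_ext => x; apply: nrm_eq0; apply/eqP.
rewrite eq_le nrm_ge0 andbT -(mul0r (nrm x)); apply: S2_op_le => // A.
by rewrite (le_trans (S2_partial_le U A))// U0 re0 expr0n.
Qed.

Definition S2_norm U : F := ofR F (Num.sqrt (re (S2_inner U U))).

Lemma S2_normD U V : S2_norm (U + V) <= S2_norm U + S2_norm V.
Proof. by rewrite -rmorphD ofR_le (ip_triangle S2_ip). Qed.

Lemma S2_norm_sqr U : S2_norm U ^+ 2 = S2_inner U U.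
Proof.
by rewrite -rmorphXn sqr_sqrtr ?(re_ip_ge0 S2_ip)// (ofR_ip S2_ip).
Qed.

Lemma S2_norm_ge0 U : 0 <= S2_norm U.
Proof. by rewrite ofR_ge0 sqrtr_ge0. Qed.

Lemma S2_normZ (a : F) U : S2_norm (a *: U) = `|a| * S2_norm U.
Proof.
apply/eqP; rewrite -(@eqrXn2 _ 2) ?S2_norm_ge0 ?mulr_ge0 ?S2_norm_ge0//.
rewrite exprMn !S2_norm_sqr (ipZr S2_ip) (ipZl S2_ip) mulrA -mul_cj.
by rewrite eqxx.
Qed.

Lemma S2_norm_eq0 U : S2_norm U = 0 -> U = 0.
Proof.
by move=> U0; apply: (ip_eq0 S2_ip); rewrite -S2_norm_sqr U0 expr0n.
Qed.

HB.instance Definition _ :=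
  Lmodule_isNormed.Build F (S2 H) S2_normD S2_normZ S2_norm_eq0.

Lemma S2_nrmE U : nrm U ^+ 2 = re (S2_inner U U).
Proof.
by apply: (@ofR_inj R F); rewrite rmorphXn ofR_nrm (ofR_ip S2_ip) S2_norm_sqr.
Qed.

Lemma S2_nrm_le U x : nrm (U x) <= nrm U * nrm x.
Proof.
by apply: S2_op_le => [|A]; [exact: nrm_ge0|rewrite S2_nrmE S2_partial_le].
Qed.

Lemma S2_subE U V x : (U - V) x = U x - V x.
Proof. by []. Qed.

Lemma S2_complete (G : set_system (S2 H)) :
  ProperFilter G -> cauchy G -> cvg G.
Proof.
move=> PG /(@cauchy_nrmP R F) cG.
have near_G (d : R) : 0 < d ->
    exists2 B : set (S2 H), G B & forall U V, B U -> B V -> nrm (U - V) < d.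
  move=> d0; have d20 : 0 < d / 2 by rewrite divr_gt0.
  have [X GX] := cG _ d20; exists [set Y | nrm (X - Y) < d / 2] => // U V /= hU hV.
  rewrite (splitr d) (le_lt_trans _ (ltrD hU hV))// [nrm (X - U)]nrmC.
  by rewrite (le_trans _ (nrmD _ _))// addrA subrK.
have hL : forall x : H, exists l : H, (fun U : S2 H => U x) @ G --> l.
  move=> x; have PG' : ProperFilter ((fun U : S2 H => U x) @ G).
    exact: fmap_proper_filter.
  suff /cauchy_cvg : cauchy ((fun U : S2 H => U x) @ G) by move=> /cvg_ex.
  apply/cauchy_nrmP => d d0.
  have p0 : 0 < nrm x + 1 by rewrite ltr_wpDl// nrm_ge0.
  have [X GX] := cG _ (divr_gt0 d0 p0); exists (X x).
  suff : G [set U | nrm (X x - U x) < d] by [].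
  apply: filterS GX => U /=; rewrite ltr_pdivlMr//; apply: le_lt_trans.
  rewrite -S2_subE (le_trans (S2_nrm_le _ _))//.
  by rewrite ler_wpM2l ?nrm_ge0// lerDl.
have [L LP] := choice hL.
have Ll : linear L.
  move=> a x y.
  apply: (cvg_nrm_unique PG (LP _)).
  rewrite [X in X @ _ --> _](_ : _ = (fun U : S2 H => a *: U x + U y)).
    by apply: cvgD (LP y); apply: cvgZ (LP x); exact: cvg_cst.
  by apply/funext => U; have [[-> _] _] := S2P U.
have D_le (d : R) : 0 < d -> exists2 B : set (S2 H), G B & forall U, B U ->
    (forall x, nrm (U x - L x) <= d * nrm x) /\
    (forall A : {fset onb H}, \sum_(i <- A) nrm (U (e i) - L (e i)) ^+ 2 <= d ^+ 2).
  move=> d0; have [B GB HB] := near_G _ d0; exists B => // U BU.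
  have ULx x : (fun V : S2 H => nrm (U x - V x)) @ G --> nrm (U x - L x).
    apply: nrm_cvg; apply: cvgB; [exact: cvg_cst|exact: LP].
  split=> [x|A].
    apply: (closed_cvg _ (@closed_le R _) _ _ (ULx x)).
    apply: filterS GB => V BV /=; rewrite -S2_subE (le_trans (S2_nrm_le _ _))//.
    by rewrite ler_wpM2r ?nrm_ge0// ltW// HB.
  have h : (fun V : S2 H => \sum_(i <- A) nrm (U (e i) - V (e i)) ^+ 2) @ G -->
      \sum_(i <- A) nrm (U (e i) - L (e i)) ^+ 2.
    by apply: sum_sqr_cvg => i; exact: ULx.
  apply: (closed_cvg _ (@closed_le R _) _ _ h).
  apply: filterS GB => V BV /=.
  apply: (@le_trans _ _ (nrm (U - V) ^+ 2)).
    by rewrite S2_nrmE; exact: (S2_partial_le (U - V)).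
  by rewrite ler_sqr ?nnegrE ?nrm_ge0 ?(ltW d0)// ltW// HB.
have L_hs : hilbert_schmidt L.
  have [B GB HB] := D_le _ ltr01; have [U BU] := filter_ex GB.
  have [DM DS] := HB U BU.
  have hD : hilbert_schmidt (fun x => U x - L x).
    have [[Ul _] _] := S2P U.
    apply/hsP; split; last by exists (1 ^+ 2).
    apply: bounded_opI DM => a x y; rewrite Ul Ll scalerBr opprD.
    by rewrite addrACA.
  rewrite (_ : L = (-1) *: (fun x => U x - L x) + U).
    by apply: hs_lin => //; exact: S2P.
  by apply/funext => x; rewrite !fctE scaleN1r opprB subrK.
have L_in : L \in @hs_pred R F H by apply/asboolP.
apply/cvg_ex; exists (S2_of L_in).
apply/(@cvg_nrmP R F _ _ G _ id) => d d0.
have d20 : 0 < d / 2 by rewrite divr_gt0.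
have [B GB HB] := D_le _ d20.
apply: filterS GB => U /HB [_ DS].
rewrite nrmC (@le_lt_trans _ _ (d / 2))//; last by rewrite ltr_pdivrMr// ltr_pMr// ltr1n.
rewrite -ler_sqr ?nnegrE ?nrm_ge0 ?(ltW d20)// S2_nrmE.
exact: S2_le_partial.
Qed.

HB.instance Definition _ := Uniform_isComplete.Build (S2 H) S2_complete.

Lemma S2_inner_norm U : S2_inner U U = `|U| ^+ 2.
Proof. by rewrite -S2_norm_sqr. Qed.

HB.instance Definition _ := isHilbert.Build R F (S2 H)
  S2_inner_cj S2_inner_lin S2_inner_norm.

End S2_inner.

Section Tensor.
Variables (R : realType) (F : scalarField R) (H : hilbertType F).

(* The space W (x) V of operators P_W O P_V. *)
Definition tensor (W V : set H) : set (S2 H) :=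
  [set T : S2 H | exists O : S2 H, forall x, T x = proj W (O (proj V x))].

Section Projection.
Variable U : set H.
Hypothesis cU : closed_subspace U.
Let ipP := inner_ip H.

Lemma proj_in x : U (proj U x). Proof. by have [] := projP x cU. Qed.

Lemma proj_orth x u : U u -> inner u (x - proj U x) = 0.
Proof. by have [_] := projP x cU; apply. Qed.

Lemma proj_uniq x p : U p -> (forall u, U u -> inner u (x - p) = 0) ->
  proj U x = p.
Proof.
move=> Up h; have [U0 UD UZ _] := cU.
have Ud : U (proj U x - p).
  by apply: UD; [exact: proj_in|rewrite -scaleN1r; exact: UZ].
apply/eqP; rewrite -subr_eq0; apply/eqP; apply: (ip_eq0 ipP).
have E : proj U x - p = (x - p) - (x - proj U x).
  by rewrite opprB [RHS]addrC addrA subrK.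
by rewrite [X in inner _ X]E (ipBr ipP) h// proj_orth// subrr.
Qed.

Lemma proj_id x : U x -> proj U x = x.
Proof.
by move=> Ux; apply: proj_uniq => // u _; rewrite subrr (ip0r ipP).
Qed.

Lemma proj_linear : linear (proj U).
Proof.
have [U0 UD UZ _] := cU => a x y; apply: proj_uniq.
  by apply: UD; [apply: UZ|]; exact: proj_in.
move=> u Uu; rewrite opprD addrACA -scalerBr inner_lin !proj_orth//.
by rewrite mulr0 addr0.
Qed.

Lemma nrm_proj x : nrm (proj U x) <= nrm x.
Proof.
rewrite -ler_sqr ?nnegrE ?nrm_ge0//.
have {2}-> : x = proj U x + (x - proj U x) by rewrite addrC subrK.
rewrite -!re_inner (ip_sqrD ipP) (proj_orth _ (proj_in x)) re0 mul0rn addr0.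
by rewrite lerDl (re_ip_ge0 ipP).
Qed.

End Projection.

Lemma tensorP W V (T : S2 H) : closed_subspace W -> closed_subspace V ->
  tensor W V T <-> forall x, T x = proj W (T (proj V x)).
Proof.
move=> cW cV; split=> [[O TO] x|h]; last by exists T.
by rewrite (TO (proj V x)) (proj_id cV (proj_in cV x)) (proj_id cW)// -?TO//
  TO; exact: proj_in.
Qed.

Lemma tensor_closed W V : closed_subspace W -> closed_subspace V ->
  closed_subspace (tensor W V).
Proof.
move=> cW cV; have lW := proj_linear cW.
have E0 (x : H) : (0 : S2 H) x = 0 by [].
have ED (T S : S2 H) x : (T + S) x = T x + S x by [].
have EZ (a : F) (T : S2 H) x : (a *: T) x = a *: T x by [].
split.
- by apply/tensorP => // x; rewrite !E0 (linear_0 lW).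
- move=> T S /(tensorP _ cW cV) hT /(tensorP _ cW cV) hS.
  apply/tensorP => // x; rewrite !ED hT hS.
  by have := lW 1 (T (proj V x)) (S (proj V x)); rewrite !scale1r => ->.
- move=> a T /(tensorP _ cW cV) hT; apply/tensorP => // x; rewrite !EZ hT.
  by have := lW a (T (proj V x)) 0; rewrite (linear_0 lW) !addr0 => ->.
move=> T clT; apply/tensorP => // x.
apply/eqP; rewrite -subr_eq0; apply/eqP; apply: nrm_eq0; apply/eqP.
rewrite eq_le nrm_ge0 andbT leNgt; apply/negP.
set d := nrm _ => d0.
have p0 : 0 < 2 * nrm x + 1 by rewrite ltr_wpDl// mulr_ge0// nrm_ge0.
have r0 : 0 < d / (2 * nrm x + 1) by rewrite divr_gt0.
have := clT (ball T (ofR F (d / (2 * nrm x + 1)))).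
case; first by apply: nbhsx_ballx; rewrite ofR_gt0.
move=> S [/(tensorP _ cW cV) hS]; rewrite -ball_normE /= nrm_lt.
rewrite ltr_pdivlMr// => hd.
have : d <= 2 * (nrm (T - S) * nrm x).
  rewrite /d.
  have -> : T x - proj W (T (proj V x)) =
      (T - S) x - proj W ((T - S) (proj V x)).
    by rewrite !S2_subE linear_sub// -hS opprB addrA subrK.
  rewrite (le_trans (nrmD _ _))// nrmN mulr2n mulrDl mul1r lerD//.
    exact: S2_nrm_le.
  rewrite (le_trans (nrm_proj cW _))// (le_trans (S2_nrm_le _ _))//.
  by rewrite ler_wpM2l ?nrm_ge0// nrm_proj.
have := nrm_ge0 (T - S); have := nrm_ge0 x; nra.
Qed.

End Tensor.

Section Fusion.
Variables (R : realType) (F : scalarField R) (K : hilbertType F).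
Variables (I : choiceType) (U : I -> set K) (u : I -> R).

Definition bessel_fusion_sequence (B : R) := forall f : K,
  (\esum_(i in [set: I]) (u i ^+ 2 * nrm (proj (U i) f) ^+ 2)%:E
     <= (B * nrm f ^+ 2)%:E)%E.

Definition fusion_frame (A B : R) :=
  [/\ 0 < A, A <= B, bessel_fusion_sequence B & forall f : K,
   ((A * nrm f ^+ 2)%:E <=
     \esum_(i in [set: I]) (u i ^+ 2 * nrm (proj (U i) f) ^+ 2)%:E)%E].

Definition fusion_riesz_sequence (A B : R) :=
  [/\ 0 < A, A <= B & forall (J : {fset I}) (f : I -> K),
   (forall j, j \in J -> U j (f j)) ->
   A * \sum_(j <- J) nrm (f j) ^+ 2
     <= nrm (\sum_(j <- J) ofR F (u j) *: f j) ^+ 2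
     <= B * \sum_(j <- J) nrm (f j) ^+ 2].

(* If exactly one of W, V consists of zero spaces only, every W_j (x) V_i is zero
   and carries no information on the other family. *)
Definition nonzero_family := exists i x, U i x /\ x != 0.

End Fusion.

(* Main.v *)
From mathcomp Require Import all_boot all_order ssralg ssrnum finmap.
From mathcomp Require Import all_classical reals ereal topology normedtype esum.
From mathcomp Require Import ring.
Require Import Defs.
Import Order.TTheory GRing.Theory Num.Theory.
Import numFieldNormedType.Exports.
Set Implicit Arguments. Unset Strict Implicit. Unset Printing Implicit Defensive.
Local Open Scope classical_set_scope.
Local Open Scope ring_scope.

(** Write [energy W w f] for the sum over j of w_j^2 |P_{W_j} f|^2, the quadratic
    form of the fusion frame operator of W.

    From the factors to the tensor product.  The projection onto W_j (x) V_i is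
    the operation T |-> P_{W_j} T P_{V_i} ([proj_tensor]).  The Hilbert-Schmidt
    norm satisfies |T|^2 = sum_k |T e_k|^2 for the orthonormal basis e
    ([S2_nrm_esum]), so an inequality on W can be applied to each vector T e_k and
    summed over k; it then holds for the projections T |-> P_{W_j} T with the same
    constants ([energy_projL], [riesz_lift]).  The adjoint is an isometry of S_2
    ([nrm_S2_adj]) which turns T P_{V_i} into P_{V_i} T^*, so an inequality on V
    passes to T |-> T P_{V_i} in the same way.  Applying one after the other
    multiplies the constants ([bessel_tensor], [frame_tensor], [riesz_tensor]).

    From the tensor product to the factors.  Rank one operators y (x) x separate
    the two factors: the energy of y (x) x for the tensor family is the product
    energy W y * energy V x ([energy_rank1]), and |y (x) x| = |y| |x|.  If P and Q
    are the sets of Rayleigh quotients energy/|.|^2 of the two families, the bounds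
    on the tensor product say that A <= p q <= B for all p in P and q in Q.  Then
    A and B split as products of bounds for P and for Q: take the optimal bound of
    P, which is sup P or inf P, and the complementary factor automatically bounds Q
    ([factor_upper], [factor_lower], [factor_bounds]).  For Riesz sequences the
    same argument is applied to the quotients |sum_j u_j f_j|^2 / sum_j |f_j|^2.

    This needs some positive quotient on each side.  For frames the lower bound
    provides one as soon as the Hilbert space is not zero.  For Bessel and Riesz
    sequences one needs nonzero vectors in both families.  In the degenerate cases,
    a zero Hilbert space or two families of zero spaces, only the signs and the
    order of the bounds matter, and A = 1 * A, B = 1 * B are suitable
    factorisations. *)

(** * Unordered sums *)

Section Sums.
Variable R : realType.

(** Turns statements about finite partial sums, the form in which inequalities
    for orthonormal bases are available, into an identity between extended reals,
    where double sums can be exchanged freely. *)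
Lemma esum_eqP (I : choiceType) (mu : I -> R) (m : R) :
  (forall A : {fset I}, \sum_(i <- A) mu i <= m) ->
  (forall M, (forall A : {fset I}, \sum_(i <- A) mu i <= M) -> m <= M) ->
  (\esum_(i in [set: I]) (mu i)%:E = m%:E)%E.
Proof.
move=> /esum_fsetP ub lub; apply/eqP; rewrite eq_le ub /=.
case E: (\esum_(i in _) _)%E ub => [r| |] // _.
  by rewrite lee_fin; apply: lub; apply/esum_fsetP; rewrite E ?leNye.
have : m <= m - 1 by apply: lub; apply/esum_fsetP; rewrite E ?leNye.
by rewrite lerDl oppr_ge0 ler10.
Qed.

Local Open Scope ereal_scope.

Lemma esum_swap (I J : choiceType) (a : I -> J -> \bar R) :
  (forall i j, 0 <= a i j) ->
  \esum_(i in [set: I]) \esum_(j in [set: J]) a i j =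
  \esum_(j in [set: J]) \esum_(i in [set: I]) a i j.
Proof.
move=> a0; rewrite !esum_esum//.
rewrite (reindex_esum ([set: J] `*`` (fun=> [set: I])) _ (fun x => (x.2, x.1)))//.
by split=> [//|[? ?] [? ?] _ _ [-> ->]//|[i j] _]; exists (j, i).
Qed.

Lemma esum_ge_term (I : choiceType) (a : I -> \bar R) i :
  (forall i, 0 <= a i) -> a i <= \esum_(i in [set: I]) a i.
Proof.
move=> a0; apply: esum_ge; exists [set i]; last by rewrite fsbig_set1.
by split.
Qed.

(** For finite [c] the two inequalities are the same one applied to [c] and to
    its inverse.  The case [c = +oo], which [esum_prod] needs since a factor may
    diverge, rests on [+oo * 0 = 0]. *)
Lemma esumZl (I : choiceType) (a : I -> \bar R) (c : \bar R) :
  (forall i, 0 <= a i) -> 0 <= c ->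
  \esum_(i in [set: I]) (c * a i) = c * \esum_(i in [set: I]) a i.
Proof.
move=> a0 c0.
have le_esumZl (r : R) (b : I -> \bar R) : (0 <= r)%R -> (forall i, 0 <= b i) ->
    \esum_(i in [set: I]) (r%:E * b i) <= r%:E * \esum_(i in [set: I]) b i.
  move=> r0 b0; apply: ge_ereal_sup => _ [A fA <-].
  rewrite -ge0_mule_fsumr//; apply: lee_wpmul2l; first by rewrite lee_fin.
  by apply: ereal_sup_ubound; exists A.
case: c c0 => [c|c0|//].
  rewrite lee_fin le_eqVlt => /predU1P[<-|c0].
    by rewrite mul0e; apply: esum1 => i _; rewrite mul0e.
  apply/eqP; rewrite eq_le le_esumZl ?(ltW c0)//=.
  (* Multiplying back by the inverse of c reduces this to the other inequality. *)
  have := le_esumZl c^-1%R (fun i => c%:E * a i).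
  rewrite invr_ge0 ltW// => /(_ isT) h.
  rewrite -lee_pdivlMl// (le_trans _ (h _))//; last first.
    by move=> i; rewrite mule_ge0// lee_fin ltW.
  by apply: le_esum => i _; rewrite muleA -EFinM mulVf ?gt_eqF// mul1e.
have [h|/existsNP[i /eqP ai]] := pselect (forall i, a i = 0).
  by rewrite !esum1 ?mule0// => i _; rewrite h mule0.
have ai0 : 0 < a i by rewrite lt_def ai a0.
rewrite gt0_mulye; last by rewrite (lt_le_trans ai0)// esum_ge_term.
apply/eqP; rewrite -leye_eq.
have /(_ i) := @esum_ge_term _ (fun j => +oo * a j) _ (fun j => mule_ge0 c0 (a0 j)).
by rewrite (gt0_mulye ai0).
Qed.

Lemma esum_prod (I J : choiceType) (a : I -> \bar R) (b : J -> \bar R) :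
  (forall i, 0 <= a i) -> (forall j, 0 <= b j) ->
  \esum_(p in [set: I * J]) (a p.1 * b p.2) =
  (\esum_(i in [set: I]) a i) * \esum_(j in [set: J]) b j.
Proof.
move=> a0 b0; rewrite [RHS]muleC -esumZl//; last exact: esum_ge0.
transitivity (\esum_(i in [set: I]) \esum_(j in [set: J]) (a i * b j)).
  rewrite esum_esum => [|i j _ _]; last exact: mule_ge0.
  by congr esum; apply/seteqP; split.
by apply: eq_esum => i _; rewrite esumZl// muleC.
Qed.

Lemma mule_fin (a b : \bar R) (u : R) : 0 < a -> 0 <= b -> a * b <= u%:E ->
  exists r : R, b = r%:E.
Proof. by move=> a0; case: b => [r||]//; [exists r|rewrite gt0_muley]. Qed.

End Sums.

(** A finite set of pairs is rarely a rectangle; extending the summand by 0 to the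
    rectangle spanned by its projections allows iterated summation. *)
Lemma sum_fset_pair (V : nmodType) (I J : choiceType) (A : {fset I})
    (B : {fset J}) (D : {fset I * J}) (g : I * J -> V) :
  (forall p, p \in D -> p.1 \in A /\ p.2 \in B) ->
  \sum_(p <- D) g p =
  \sum_(j <- B) \sum_(i <- A) if (i, j) \in D then g (i, j) else 0.
Proof.
move=> DAB; rewrite exchange_big /=.
transitivity (\sum_(p <- [seq (i, j) | i <- A, j <- B] | p \in D) g p); last first.
  by rewrite big_mkcond big_allpairs.
rewrite -[RHS]big_filter.
apply: perm_big; apply: uniq_perm; first exact: fset_uniq.
  by apply: filter_uniq; apply: allpairs_uniq => // -[? ?] [? ?].
move=> [i j]; rewrite mem_filter; case: (boolP (_ \in D)) => //= /DAB[iA jB].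
by symmetry; apply/allpairsP; exists (i, j).
Qed.

(** * Factoring the bounds of a product *)

Section Factorisation.
Variable R : realType.
Implicit Types (P Q : set R) (A B : R).

(** The factor [b = sup P] is optimal, and this is what makes the other factor
    work: [q <= B / b] means [b <= B / q], and [B / q] is an upper bound of [P].
    The two positive elements make [P] bounded and [b] invertible. *)
Lemma factor_upper P Q B : (exists2 p, P p & 0 < p) -> (exists2 q, Q q & 0 < q) ->
  (forall p q, P p -> Q q -> p * q <= B) ->
  exists b c, [/\ 0 < b, B = c * b, (forall p, P p -> p <= b) &
    forall q, Q q -> q <= c].
Proof.
move=> [p Pp p0] [q Qq q0] PQ.
have ubP : has_sup P.
  by split; [exists p|exists (B / q) => s Ps; rewrite ler_pdivlMr// PQ].
have Psup s : P s -> s <= sup P by exact: sup_upper_bound.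
have b0 : 0 < sup P by rewrite (lt_le_trans p0)// Psup.
exists (sup P), (B / sup P); split => //; first by rewrite divfK// gt_eqF.
(* For s <= 0, dividing by s gives no upper bound of P, but s * b <= 0 <= B. *)
move=> s Qs; rewrite ler_pdivlMr//; have [s0|s0] := leP s 0.
  rewrite (@le_trans _ _ 0)// ?mulr_le0_ge0// ?ltW//.
  by rewrite (lt_le_trans _ (PQ _ _ Pp Qq))// mulr_gt0.
rewrite mulrC -ler_pdivlMr//; apply: ge_sup; first by exists p.
by move=> t Pt; rewrite ler_pdivlMr// PQ.
Qed.

(** Inversion exchanges lower and upper bounds of sets of positive numbers, so
    this is [factor_upper] for the inverses and the constant [A^-1]. *)
Lemma factor_lower P Q A : P !=set0 -> Q !=set0 ->
  (forall p, P p -> 0 < p) -> (forall q, Q q -> 0 < q) -> 0 < A ->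
  (forall p q, P p -> Q q -> A <= p * q) ->
  exists b c, [/\ 0 < b, 0 < c, A = c * b, (forall p, P p -> b <= p) &
    forall q, Q q -> c <= q].
Proof.
move=> [p Pp] [q Qq] P0 Q0 A0 PQ.
have [| | |b [c [b0 E hb hc]]] :=
    @factor_upper [set x^-1 | x in P] [set x^-1 | x in Q] A^-1.
- by exists p^-1; [exists p|rewrite invr_gt0 P0].
- by exists q^-1; [exists q|rewrite invr_gt0 Q0].
- move=> _ _ [s Ps <-] [t Qt <-]; have st0 : 0 < s * t.
    by apply: mulr_gt0; [exact: P0|exact: Q0].
  by rewrite -invfM lef_pV2 ?posrE// PQ.
have c0 : 0 < c by apply: lt_le_trans (hc q^-1 _); [rewrite invr_gt0 Q0|exists q].
exists b^-1, c^-1; rewrite !invr_gt0; split=> //.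
- by rewrite -invfM -E invrK.
- move=> s Ps; have s0 := P0 _ Ps.
  by rewrite -[s]invrK lef_pV2 ?posrE ?invr_gt0//; apply: hb; exists s.
- move=> s Qs; have s0 := Q0 _ Qs.
  by rewrite -[s]invrK lef_pV2 ?posrE ?invr_gt0//; apply: hc; exists s.
Qed.

(** The lower and the upper constants are factored independently; the order
    [A1 <= B1], [A2 <= B2] follows because [P] and [Q] are nonempty. *)
Lemma factor_bounds P Q A B : P !=set0 -> Q !=set0 ->
  (forall p, P p -> 0 < p) -> (forall q, Q q -> 0 < q) -> 0 < A ->
  (forall p q, P p -> Q q -> A <= p * q <= B) ->
  exists A1 B1 A2 B2, [/\ A = A2 * A1, B = B2 * B1,
    0 < A1 <= B1 /\ (forall p, P p -> A1 <= p <= B1) &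
    0 < A2 <= B2 /\ (forall q, Q q -> A2 <= q <= B2)].
Proof.
move=> nP nQ P0 Q0 A0 PQ; move: (nP) (nQ) => [p Pp] [q Qq].
have [p' q' Pp' Qq'|A1 [A2 [A10 A20 EA hA1 hA2]]] := factor_lower nP nQ P0 Q0 A0.
  by have /andP[] := PQ _ _ Pp' Qq'.
have [| |p' q' Pp' Qq'|B1 [B2 [B10 EB hB1 hB2]]] := @factor_upper P Q B.
- by exists p => //; exact: P0.
- by exists q => //; exact: Q0.
- by have /andP[] := PQ _ _ Pp' Qq'.
exists A1, B1, A2, B2; split=> //.
- split; first by rewrite A10 (le_trans (hA1 p _) (hB1 p _)).
  by move=> s Ps; rewrite hA1 ?hB1.
- split; first by rewrite A20 (le_trans (hA2 q _) (hB2 q _)).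
  by move=> s Qs; rewrite hA2 ?hB2.
Qed.

End Factorisation.

(** * Hilbert-Schmidt operators *)

Section HilbertSchmidt.
Variables (R : realType) (F : scalarField R) (H : hilbertType F).
Implicit Types (x y z : H) (S T : S2 H).
Local Notation e := (@elt R F H (onb H)).

Lemma inner_ext y z : (forall x, inner x y = inner x z) -> y = z.
Proof.
move=> yz; apply/eqP; rewrite -subr_eq0; apply/eqP.
by apply: (ip_eq0 (inner_ip H)); rewrite (ipBr (inner_ip H)) yz subrr.
Qed.

Lemma nrm_innerC x y : nrm (inner x y) = nrm (inner y x).
Proof. by rewrite -inner_cj nrm_cj. Qed.

(** Bessel's inequality is one half.  For the other, [x] is the limit of its
    Fourier sums, hence [|x|^2] is the limit of their inner products with [x],
    which are exactly the partial sums on the left. *)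
Lemma parseval x :
  (\esum_(i in [set: onb H]) (nrm (inner (e i) x) ^+ 2)%:E = (nrm x ^+ 2)%:E)%E.
Proof.
apply: esum_eqP => [A|M xM]; first exact: (bessel_ineq (@onb_orthonormal _ _ H)).
have xx : inner x (fsum e (fcoef e x) A) @[A --> @summability.totally (onb H)]
    --> inner x x by apply: inner_cvg; exact: onb_cvg.
rewrite -re_inner; apply: (closed_cvg _ (@closed_le R _) _ _ (re_cvg xx)).
apply: nearW => A; apply: le_trans (xM A); rewrite (ip_sumr (inner_ip H)) re_sum.
apply: ler_sum => i _; rewrite (ipZr (inner_ip H)) /fcoef -(inner_cj (e i) x).
by rewrite -nrm_sqr ofRK.
Qed.

Lemma S2_nrm_esum T :
  (\esum_(i in [set: onb H]) (nrm (T (e i)) ^+ 2)%:E = (nrm T ^+ 2)%:E)%E.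
Proof.
apply: esum_eqP => [A|M TM]; rewrite S2_nrmE; first exact: S2_partial_le.
exact: S2_le_partial.
Qed.

Definition hsS2 (T : H -> H) (hT : hilbert_schmidt T) : S2 H :=
  S2_of (asboolT hT : T \in @hs_pred R F H).

Lemma S2_linear T : linear T.
Proof. by have [[]] := S2P T. Qed.

Lemma hsI (T : H -> H) (M N : R) : linear T ->
  (forall x, nrm (T x) <= M * nrm x) ->
  (\esum_(i in [set: onb H]) (nrm (T (e i)) ^+ 2)%:E <= N%:E)%E ->
  hilbert_schmidt T.
Proof.
move=> lT TM TN; split; first exact: bounded_opI TM.
by rewrite (le_lt_trans TN)// ltry.
Qed.

Lemma S2_sumE (J : Type) (r : seq J) (T : J -> S2 H) x :
  (\sum_(j <- r) T j) x = \sum_(j <- r) T j x.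
Proof. by elim/big_rec2 : _ => // j y S _ <-. Qed.

Lemma inner_adj T x y : inner (adj T y) x = inner y (T x).
Proof. by apply: adjP; have [] := S2P T. Qed.

Lemma inner_adjr T x y : inner y (adj T x) = inner (T y) x.
Proof. by rewrite -inner_cj inner_adj inner_cj. Qed.

(** Both sides are the sum of the squared moduli of all matrix coefficients of
    [T] in the basis, by rows or by columns. *)
Lemma esum_adj T :
  (\esum_(i in [set: onb H]) (nrm (adj T (e i)) ^+ 2)%:E = (nrm T ^+ 2)%:E)%E.
Proof.
transitivity (\esum_(i in [set: onb H]) \esum_(j in [set: onb H])
    (nrm (inner (e j) (adj T (e i))) ^+ 2)%:E)%E.
  by apply: eq_esum => i _; rewrite parseval.
rewrite esum_swap => [|i j]; last by rewrite lee_fin sqr_ge0.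
rewrite -S2_nrm_esum; apply: eq_esum => j _; rewrite -parseval.
by apply: eq_esum => i _; rewrite inner_adjr nrm_innerC.
Qed.

Lemma adj_hs T : hilbert_schmidt (adj T).
Proof.
have lT : linear (adj T).
  by move=> a x y; apply: inner_ext => z; rewrite inner_lin !inner_adjr inner_lin.
apply: (hsI (M := nrm T) lT); last by rewrite esum_adj.
move=> x; have [->|a0] := eqVneq (nrm (adj T x)) 0.
  by rewrite mulr_ge0// nrm_ge0.
have {}a0 : 0 < nrm (adj T x) by rewrite lt_def a0 nrm_ge0.
(* |T^* x|^2 = <x, T T^* x> <= |x| |T| |T^* x|, then cancel |T^* x|. *)
rewrite -(ler_pM2r a0) -expr2 -re_inner inner_adj.
rewrite (le_trans (ler_norm _))// (le_trans (re_nrm _))//.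
rewrite (le_trans (inner_CS _ _))// mulrAC mulrC.
by rewrite ler_wpM2r ?nrm_ge0// S2_nrm_le.
Qed.

Definition S2_adj T : S2 H := hsS2 (adj_hs T).

Lemma inner_S2_adjl T x y : inner (S2_adj T y) x = inner y (T x).
Proof. exact: inner_adj. Qed.

Lemma inner_S2_adjr T x y : inner y (S2_adj T x) = inner (T y) x.
Proof. exact: inner_adjr. Qed.

Lemma S2_adjK : involutive S2_adj.
Proof.
move=> T; apply: S2_ext => x; apply: inner_ext => y.
by rewrite inner_S2_adjr inner_S2_adjl.
Qed.

Lemma S2_adj_lin (a : F) S T : S2_adj (a *: S + T) = cj a *: S2_adj S + S2_adj T.
Proof.
apply: S2_ext => x; apply: inner_ext => y.
rewrite S2E inner_S2_adjr inner_lin !inner_S2_adjr S2E.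
by rewrite (ipDl (inner_ip H)) (ipZl (inner_ip H)).
Qed.

Lemma S2_adjD S T : S2_adj (S + T) = S2_adj S + S2_adj T.
Proof. by rewrite -[S]scale1r S2_adj_lin rmorph1 !scale1r. Qed.

Lemma S2_adj0 : S2_adj 0 = 0.
Proof.
apply: S2_ext => x; apply: inner_ext => y; rewrite inner_S2_adjr.
by rewrite (ip0l (inner_ip H)) (ip0r (inner_ip H)).
Qed.

Lemma S2_adjZ (r : R) T : S2_adj (ofR F r *: T) = ofR F r *: S2_adj T.
Proof. by rewrite -[_ *: T]addr0 S2_adj_lin S2_adj0 addr0 cj_ofR. Qed.

Lemma nrm_S2_adj T : nrm (S2_adj T) = nrm T.
Proof.
apply/eqP; rewrite -(@eqrXn2 _ 2) ?nrm_ge0//; apply/eqP.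
by apply: EFin_inj; rewrite -S2_nrm_esum -esum_adj.
Qed.

(** An additive isometry preserves the real part of the inner product, since
    [|S + T|^2 = |S|^2 + |T|^2 + 2 Re <S, T>]. *)
Lemma re_inner_S2_adj S T : re (inner (S2_adj S) (S2_adj T)) = re (inner S T).
Proof.
have := ip_sqrD (inner_ip (S2 H)) (S2_adj S) (S2_adj T).
rewrite -S2_adjD !re_inner !nrm_S2_adj -!re_inner (ip_sqrD (inner_ip (S2 H))).
by move/addrI/eqP; rewrite eqrMn2r// => /eqP.
Qed.

Section Projections.
Variables (U : set H) (cU : closed_subspace U).

Lemma proj_selfadj x y : inner (proj U x) y = inner x (proj U y).
Proof.
transitivity (inner (proj U x) (proj U y)).
  apply/eqP; rewrite -subr_eq0 -(ipBr (inner_ip H)).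
  by rewrite proj_orth//; exact: proj_in.
apply/eqP; rewrite eq_sym -subr_eq0 -(ipBl (inner_ip H)) -inner_cj.
by rewrite proj_orth ?rmorph0//; exact: proj_in.
Qed.

Lemma projL_hs T : hilbert_schmidt (fun x => proj U (T x)).
Proof.
apply: (hsI (M := nrm T) (N := nrm T ^+ 2)).
- by move=> a x y; rewrite S2_linear proj_linear.
- by move=> x; rewrite (le_trans (nrm_proj cU _))// S2_nrm_le.
- rewrite -S2_nrm_esum; apply: le_esum => i _; rewrite lee_fin.
  by rewrite ler_sqr ?nnegrE ?nrm_ge0// nrm_proj.
Qed.

Definition projL T : S2 H := hsS2 (projL_hs T).

(** [T \o P_U], obtained as [(P_U \o T^* )^*]: with this encoding, facts about
    composition on the left transfer through the isometry [S2_adj]. *)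
Definition projR T : S2 H := S2_adj (projL (S2_adj T)).

Lemma projLE T x : projL T x = proj U (T x).
Proof. by []. Qed.

Lemma projRE T x : projR T x = T (proj U x).
Proof.
apply: inner_ext => y; rewrite inner_S2_adjr projLE proj_selfadj.
by rewrite inner_S2_adjl.
Qed.

Lemma S2_adj_projR T : S2_adj (projR T) = projL (S2_adj T).
Proof. exact: S2_adjK. Qed.

Lemma S2_adj_in T x : (forall z, T z = T (proj U z)) -> U (S2_adj T x).
Proof.
move=> TU; have -> : T = projR T by apply: S2_ext => z; rewrite projRE.
by rewrite S2_adj_projR projLE; exact: proj_in.
Qed.

Lemma inner_projL S T : inner (projL S) T = inner S (projL T).
Proof.
rewrite /inner /= /S2_inner /trace; congr summability.sum; apply/funext => i /=.
by rewrite (inner_adjr (projL S)) inner_adjr projLE proj_selfadj.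
Qed.

End Projections.

Section TensorProjection.
Variables (W V : set H).
Hypotheses (cW : closed_subspace W) (cV : closed_subspace V).

(** Moving the two projections from [S = P_W S P_V] to [T] gives
    [<S, T> = <S, P_W T P_V> = 0].  The one on the right crosses the inner product
    after taking adjoints, which is known for real parts only; this suffices because
    the tensor space is stable under multiplication by scalars. *)
Lemma inner_tensor_eq0 S T : tensor W V S ->
  (forall x, proj W (T (proj V x)) = 0) -> inner S T = 0.
Proof.
move=> WVS T0; suff re0 S' : tensor W V S' -> re (inner S' T) = 0.
  have [_ _ WVZ _] := tensor_closed cW cV.
  apply: nrm_eq0; apply/eqP; rewrite -[_ == 0](@expf_eq0 _ _ 2).
  (* |<S, T>|^2 is the real part of <a S, T> for the scalar a = <S, T>. *)
  rewrite -[nrm _ ^+ 2](ofRK F) nrm_sqr mulrC -[X in X * _]cjK.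
  rewrite -[cj (cj _) * _](ipZl (inner_ip _)).
  by rewrite cjK re0//; exact: WVZ.
move=> /(tensorP _ cW cV) hS.
have -> : S' = projL cW (projR cV S').
  by apply: S2_ext => x; rewrite projLE projRE -hS.
rewrite inner_projL -re_inner_S2_adj S2_adj_projR inner_projL.
rewrite -(S2_adj_projR cV).
have -> : projR cV (projL cW T) = 0 by apply: S2_ext => x; rewrite projRE projLE T0.
by rewrite S2_adj0 (ip0r (inner_ip _)) re0.
Qed.

Lemma proj_tensor T : proj (tensor W V) T = projL cW (projR cV T).
Proof.
apply: proj_uniq; first exact: tensor_closed.
  by exists T => x; rewrite projLE projRE.
move=> S WVS; apply: inner_tensor_eq0 WVS _ => x.
rewrite S2_subE projLE projRE (proj_id cV (proj_in cV x)).
by rewrite (linear_sub (proj_linear cW)) (proj_id cW (proj_in cW _)) subrr.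
Qed.

End TensorProjection.

Section RankOne.

Lemma esum_rank1 y x : (\esum_(i in [set: onb H])
  (nrm (inner x (e i) *: y) ^+ 2)%:E = ((nrm y * nrm x) ^+ 2)%:E)%E.
Proof.
rewrite exprMn EFinM -(parseval x).
rewrite -esumZl => [|i|]; rewrite ?lee_fin ?sqr_ge0//.
by apply: eq_esum => i _; rewrite -EFinM nrmZ exprMn mulrC nrm_innerC.
Qed.

Lemma rank1_hs y x : hilbert_schmidt (fun z => inner x z *: y).
Proof.
apply: (hsI (M := nrm y * nrm x)); last by rewrite esum_rank1.
- by move=> a z z'; rewrite inner_lin scalerDl scalerA.
- by move=> z; rewrite nrmZ mulrC -mulrA ler_wpM2l ?nrm_ge0// inner_CS.
Qed.

Definition rank1 y x : S2 H := hsS2 (rank1_hs y x).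

Lemma rank1E y x z : rank1 y x z = inner x z *: y.
Proof. by []. Qed.

Lemma nrm_rank1 y x : nrm (rank1 y x) = nrm y * nrm x.
Proof.
apply/eqP; rewrite -(@eqrXn2 _ 2) ?mulr_ge0 ?nrm_ge0//; apply/eqP.
by apply: EFin_inj; rewrite -S2_nrm_esum esum_rank1.
Qed.

Lemma tensor_proj_rank1 W V (cW : closed_subspace W) (cV : closed_subspace V) y x :
  projL cW (projR cV (rank1 y x)) = rank1 (proj W y) (proj V x).
Proof.
apply: S2_ext => z; rewrite projLE projRE !rank1E proj_selfadj//.
have := proj_linear cW (inner x (proj V z)) y 0.
by rewrite (linear_0 (proj_linear cW)) !addr0.
Qed.

Lemma tensor_rank1 W V (cW : closed_subspace W) (cV : closed_subspace V) y x :
  W y -> V x -> tensor W V (rank1 y x).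
Proof.
move=> Wy Vx; apply/tensorP => // z.
by rewrite -{1}(proj_id cW Wy) -{1}(proj_id cV Vx) -tensor_proj_rank1 projLE projRE.
Qed.

Lemma sum_rank1 (I J : Type) (r : seq I) (s : seq J) (y : I -> H) (x : J -> H) :
  \sum_(j <- s) \sum_(i <- r) rank1 (y i) (x j) =
  rank1 (\sum_(i <- r) y i) (\sum_(j <- s) x j).
Proof.
apply: S2_ext => z; rewrite rank1E (ip_suml (inner_ip H)) scaler_suml S2_sumE.
apply: eq_bigr => j _; rewrite S2_sumE scaler_sumr.
by apply: eq_bigr => i _; rewrite rank1E.
Qed.

End RankOne.

End HilbertSchmidt.

(** * The energy of a family of subspaces *)

Lemma sqr_mul_ge0 (R : realType) (a b : R) : (0 <= (a ^+ 2 * b ^+ 2)%:E)%E.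
Proof. by rewrite lee_fin mulr_ge0// sqr_ge0. Qed.

Lemma nrm_sqr_gt0 (R : realType) (F : scalarField R) (V : normedZmodType F) (f : V) :
  f != 0 -> 0 < nrm f ^+ 2.
Proof.
move=> f0; rewrite exprn_gt0// lt_def nrm_ge0 andbT.
by apply: contra f0 => /eqP /nrm_eq0 ->.
Qed.

Section Energy.
Variables (R : realType) (F : scalarField R) (K : hilbertType F).
Variables (I : choiceType) (U : I -> set K) (u : I -> R).

(** The quadratic form [<S f, f>] of the fusion frame operator [S] of the family;
    it may be infinite. *)
Definition energy (f : K) : \bar R :=
  (\esum_(i in [set: I]) (u i ^+ 2 * nrm (proj (U i) f) ^+ 2)%:E)%E.

Lemma energy_ge0 f : (0 <= energy f)%E.
Proof. by apply: esum_ge0 => i _; exact: sqr_mul_ge0. Qed.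

Hypothesis cU : forall i, closed_subspace (U i).

Lemma energy0 : energy 0 = 0%E.
Proof.
apply: esum1 => i _; rewrite proj_id ?nrm0 ?expr0n ?mulr0//.
by have [] := cU i.
Qed.

Lemma bessel_ge0 B : bessel_fusion_sequence U u B -> (exists f : K, f != 0) -> 0 <= B.
Proof.
move=> hB [f f0]; have := le_trans (energy_ge0 f) (hB f).
by rewrite lee_fin pmulr_lge0// nrm_sqr_gt0.
Qed.

Lemma energy_eq0 f : ~ nonzero_family U -> energy f = 0%E.
Proof.
move=> nU; apply: esum1 => i _; rewrite (_ : proj (U i) f = 0).
  by rewrite nrm0 expr0n mulr0.
apply: contrapT => /eqP p0; apply: nU; exists i, (proj (U i) f); split=> //.
exact: proj_in.
Qed.

Lemma energy_gt0 : (forall i, 0 < u i) -> nonzero_family U ->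
  exists2 f, f != 0 & (0 < energy f)%E.
Proof.
move=> u0 [i [f [Uf f0]]]; exists f => //.
apply: lt_le_trans (@esum_ge_term _ _ _ i _); last first.
  by move=> j; exact: sqr_mul_ge0.
by rewrite lte_fin proj_id// mulr_gt0 ?nrm_sqr_gt0 ?exprn_gt0.
Qed.

End Energy.

(** * From vectors to Hilbert-Schmidt operators *)

Section Lifting.
Variables (R : realType) (F : scalarField R) (H : hilbertType F).
Variables (J : choiceType) (W : J -> set H) (w : J -> R).
Hypothesis cW : forall j, closed_subspace (W j).
Implicit Types (S : S2 H).
Local Notation e := (@elt R F H (onb H)).

(** The identity that carries inequalities from vectors to Hilbert-Schmidt
    operators: [|P S|^2] is the sum of [|P (S e_k)|^2] over the basis, and the two
    sums of nonnegative terms may be exchanged. *)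
Lemma energy_projL S :
  (\esum_(j in [set: J]) (w j ^+ 2 * nrm (projL (cW j) S) ^+ 2)%:E =
   \esum_(k in [set: onb H]) energy W w (S (e k)))%E.
Proof.
rewrite esum_swap => [|k j]; last exact: sqr_mul_ge0.
apply: eq_esum => j _; rewrite EFinM -S2_nrm_esum.
by rewrite -esumZl => [|k|]; rewrite ?lee_fin ?sqr_ge0.
Qed.

Lemma scaled_S2_nrm (A : R) S : 0 <= A ->
  ((A * nrm S ^+ 2)%:E =
   \esum_(k in [set: onb H]) (A * nrm (S (e k)) ^+ 2)%:E)%E.
Proof.
by move=> A0; rewrite EFinM -S2_nrm_esum -esumZl => // k; rewrite lee_fin sqr_ge0.
Qed.

Lemma energy_projL_le B S : 0 <= B -> bessel_fusion_sequence W w B ->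
  (\esum_(j in [set: J]) (w j ^+ 2 * nrm (projL (cW j) S) ^+ 2)%:E <=
   (B * nrm S ^+ 2)%:E)%E.
Proof.
move=> B0 hB; rewrite energy_projL scaled_S2_nrm//.
by apply: le_esum => k _; exact: hB.
Qed.

Lemma energy_projL_ge A S : 0 <= A ->
  (forall f, ((A * nrm f ^+ 2)%:E <= energy W w f)%E) ->
  ((A * nrm S ^+ 2)%:E <=
   \esum_(j in [set: J]) (w j ^+ 2 * nrm (projL (cW j) S) ^+ 2)%:E)%E.
Proof.
move=> A0 hA; rewrite energy_projL scaled_S2_nrm//.
by apply: le_esum => k _; exact: hA.
Qed.

(** The Riesz inequalities for the vectors [S_j e_k], summed over the basis. *)
Lemma riesz_lift A B (D : {fset J}) (S : J -> S2 H) :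
  fusion_riesz_sequence W w A B -> (forall j x, j \in D -> W j (S j x)) ->
  A * \sum_(j <- D) nrm (S j) ^+ 2
    <= nrm (\sum_(j <- D) ofR F (w j) *: S j) ^+ 2
    <= B * \sum_(j <- D) nrm (S j) ^+ 2.
Proof.
move=> [A0 AB hW] WS.
have sumE (c : R) : 0 <= c -> ((c * \sum_(j <- D) nrm (S j) ^+ 2)%:E =
    \esum_(k in [set: onb H]) (c * \sum_(j <- D) nrm (S j (e k)) ^+ 2)%:E)%E.
  move=> c0; rewrite EFinM -sumEFin; under eq_bigr do rewrite -S2_nrm_esum.
  rewrite -esum_sum; last by move=> k j _ _; rewrite lee_fin sqr_ge0.
  rewrite -esumZl//; last first.
    by move=> k; rewrite sumEFin lee_fin sumr_ge0// => j _; exact: sqr_ge0.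
  by apply: eq_esum => k _; rewrite sumEFin.
have h k : A * \sum_(j <- D) nrm (S j (e k)) ^+ 2
    <= nrm ((\sum_(j <- D) ofR F (w j) *: S j) (e k)) ^+ 2
    <= B * \sum_(j <- D) nrm (S j (e k)) ^+ 2.
  rewrite S2_sumE; apply: (hW D (fun j => S j (e k))) => j jD; exact: WS.
rewrite -!lee_fin -S2_nrm_esum !sumE ?(ltW A0) ?(le_trans (ltW A0))//.
by apply/andP; split; apply: le_esum => k _; rewrite lee_fin; have /andP[] := h k.
Qed.

End Lifting.

(** * From the factors to the tensor product *)

Section TensorFamily.
Variables (R : realType) (F : scalarField R) (H : hilbertType F).
Variables (J I : choiceType) (W : J -> set H) (V : I -> set H).
Variables (w : J -> R) (v : I -> R).
Hypothesis cW : forall j, closed_subspace (W j).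
Hypothesis cV : forall i, closed_subspace (V i).
Hypothesis w_gt0 : forall j, 0 < w j.
Hypothesis v_gt0 : forall i, 0 < v i.
Implicit Types (S T : S2 H) (x y : H).

Definition tensor_family (p : J * I) : set (S2 H) := tensor (W p.1) (V p.2).
Definition tensor_weight (p : J * I) : R := v p.2 * w p.1.

Local Notation WV := tensor_family.
Local Notation wv := tensor_weight.

Lemma energy_tensor T : energy WV wv T =
  (\esum_(i in [set: I]) ((v i ^+ 2)%:E * \esum_(j in [set: J])
     (w j ^+ 2 * nrm (projL (cW j) (projR (cV i) T)) ^+ 2)%:E))%E.
Proof.
transitivity (\esum_(i in [set: I]) \esum_(j in [set: J])
   ((v i ^+ 2)%:E * (w j ^+ 2 * nrm (projL (cW j) (projR (cV i) T)) ^+ 2)%:E))%E.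
  rewrite esum_swap; last first.
    by move=> i j; rewrite mule_ge0 ?sqr_mul_ge0// lee_fin sqr_ge0.
  rewrite esum_esum => [|j i _ _]; last first.
    by rewrite mule_ge0 ?sqr_mul_ge0// lee_fin sqr_ge0.
  rewrite /energy (_ : _ `*`` _ = setT); last by apply/seteqP; split.
  apply: eq_esum => p _; rewrite /tensor_family proj_tensor//.
  by rewrite /tensor_weight exprMn -mulrA EFinM.
apply: eq_esum => i _; rewrite esumZl// => [j|]; first exact: sqr_mul_ge0.
by rewrite lee_fin sqr_ge0.
Qed.

(** The passage to adjoints, which makes the bounds of [V] applicable to
    compositions with projections on the right. *)
Lemma scaled_energy_projR c T : 0 <= c ->
 (\esum_(i in [set: I]) ((v i ^+ 2)%:E * (c * nrm (projR (cV i) T) ^+ 2)%:E) =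
  c%:E * \esum_(i in [set: I]) (v i ^+ 2 * nrm (projL (cV i) (S2_adj T)) ^+ 2)%:E)%E.
Proof.
move=> c0; rewrite -esumZl//; last by move=> i; exact: sqr_mul_ge0.
by apply: eq_esum => i _; rewrite -!EFinM mulrCA nrm_S2_adj.
Qed.

(** Bounding the inner sum of [energy_tensor] by [W] leaves [BW] times a sum that
    [V] bounds.  Monotonicity of this product needs nonnegative constants, which
    hold once the Hilbert space is not zero. *)
Lemma bessel_tensor BW BV : bessel_fusion_sequence W w BW ->
  bessel_fusion_sequence V v BV -> bessel_fusion_sequence WV wv (BV * BW).
Proof.
move=> hW hV T; have [->|/eqP T0] := pselect (T = 0).
  rewrite -/(energy WV wv 0) energy0 ?nrm0 ?expr0n ?mulr0// => p.
  exact: tensor_closed.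
have nH : exists f : H, f != 0.
  apply: contrapT => nH; case/eqP: T0; apply: S2_ext => x.
  by apply: contrapT => /eqP Tx; apply: nH; exists (T x).
have BW0 := bessel_ge0 hW nH; have BV0 := bessel_ge0 hV nH.
rewrite -/(energy WV wv T) energy_tensor.
apply: (@le_trans _ _ (\esum_(i in [set: I])
    ((v i ^+ 2)%:E * (BW * nrm (projR (cV i) T) ^+ 2)%:E))%E).
  apply: le_esum => i _; apply: lee_wpmul2l; first by rewrite lee_fin sqr_ge0.
  exact: energy_projL_le.
rewrite scaled_energy_projR// -mulrA mulrCA EFinM -[nrm T]nrm_S2_adj.
by apply: lee_wpmul2l => //; exact: energy_projL_le.
Qed.

Lemma frame_tensor AW BW AV BV : fusion_frame W w AW BW ->
  fusion_frame V v AV BV -> fusion_frame WV wv (AV * AW) (BV * BW).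
Proof.
move=> [AW0 ABW bW hW] [AV0 ABV bV hV]; split.
- by rewrite mulr_gt0.
- by rewrite ler_pM// ltW.
- exact: bessel_tensor.
move=> T; rewrite -/(energy WV wv T) energy_tensor.
apply: (@le_trans _ _ (\esum_(i in [set: I])
    ((v i ^+ 2)%:E * (AW * nrm (projR (cV i) T) ^+ 2)%:E))%E).
  rewrite scaled_energy_projR ?(ltW AW0)// -mulrA mulrCA EFinM -[nrm T]nrm_S2_adj.
  by apply: lee_wpmul2l; [rewrite lee_fin ltW|apply: energy_projL_ge => //; exact: ltW].
apply: le_esum => i _; apply: lee_wpmul2l; first by rewrite lee_fin sqr_ge0.
by apply: energy_projL_ge => //; exact: ltW.
Qed.

(** With [S_i] the sum of [w_j T_ji] over [j], the sum to estimate is that of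
    [v_i S_i] over [i].  The inequalities for [V] apply to the adjoints of the [S_i],
    whose values lie in [V_i], and compare it with the sum of the [|S_i|^2]; those
    for [W] compare [|S_i|^2] with the sum of the [|T_ji|^2] over [j]. *)
Lemma riesz_tensor AW BW AV BV : fusion_riesz_sequence W w AW BW ->
  fusion_riesz_sequence V v AV BV ->
  fusion_riesz_sequence WV wv (AV * AW) (BV * BW).
Proof.
move=> hW hV; have [AW0 ABW _] := hW; have [AV0 ABV _] := hV.
split=> [||D T WVT]; first by rewrite mulr_gt0.
  by rewrite ler_pM// ltW.
pose T' j i : S2 H := if (j, i) \in D then T (j, i) else 0.
have T'WV j i x : T' j i x = proj (W j) (T' j i (proj (V i) x)).
  rewrite /T'; case: ifP => [|_]; last by rewrite (linear_0 (proj_linear (cW j))).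
  by move=> /WVT; rewrite /tensor_family /= => /tensorP; apply.
pose D1 := [fset p.1 | p in D]%fset; pose D2 := [fset p.2 | p in D]%fset.
have DD p : p \in D -> p.1 \in D1 /\ p.2 \in D2.
  by move=> pD; split; apply: in_imfset.
pose S i := \sum_(j <- D1) ofR F (w j) *: T' j i.
have -> : \sum_(p <- D) nrm (T p) ^+ 2 =
    \sum_(i <- D2) \sum_(j <- D1) nrm (T' j i) ^+ 2.
  rewrite (sum_fset_pair _ DD); apply: eq_bigr => i _; apply: eq_bigr => j _.
  by rewrite /T'; case: ifP => // _; rewrite nrm0 expr0n.
have -> : \sum_(p <- D) ofR F (wv p) *: T p = \sum_(i <- D2) ofR F (v i) *: S i.
  rewrite (sum_fset_pair _ DD); apply: eq_bigr => i _; rewrite scaler_sumr.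
  apply: eq_bigr => j _; rewrite /T' scalerA -rmorphM /tensor_weight /=.
  by case: ifP => // _; rewrite scaler0.
have SV i z : S i z = S i (proj (V i) z).
  rewrite /S !S2_sumE; apply: eq_bigr => j _.
  rewrite -[ofR F _ *: _]addr0 !S2E T'WV [in RHS]T'WV.
  by rewrite (proj_id (cV i) (proj_in (cV i) _)).
have hS := @riesz_lift _ _ _ _ V v AV BV D2 (fun i => S2_adj (S i)) hV
  (fun i x _ => S2_adj_in (cV i) x (SV i)).
have : AV * \sum_(i <- D2) nrm (S i) ^+ 2 <=
    nrm (\sum_(i <- D2) ofR F (v i) *: S i) ^+ 2 <=
    BV * \sum_(i <- D2) nrm (S i) ^+ 2.
  rewrite -[nrm (\sum_(i <- D2) _)]nrm_S2_adj.
  rewrite (big_morph _ (@S2_adjD _ _ H) (@S2_adj0 _ _ H)).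
  rewrite (eq_bigr (fun i => ofR F (v i) *: S2_adj (S i))) => [|i _]; last exact: S2_adjZ.
  by rewrite (eq_bigr (fun i => nrm (S2_adj (S i)) ^+ 2)) => // i _; rewrite nrm_S2_adj.
have Sb i : AW * \sum_(j <- D1) nrm (T' j i) ^+ 2 <= nrm (S i) ^+ 2 <=
    BW * \sum_(j <- D1) nrm (T' j i) ^+ 2.
  by apply: riesz_lift hW _ => // j x _; rewrite T'WV; exact: proj_in.
move=> /andP[lo up]; apply/andP; split.
  apply: le_trans lo; rewrite -mulrA ler_pM2l// mulr_sumr.
  by apply: ler_sum => i _; have /andP[] := Sb i.
apply: le_trans up _; rewrite -mulrA ler_wpM2l ?mulr_sumr//.
  exact: le_trans (ltW AV0) ABV.
by apply: ler_sum => i _; have /andP[] := Sb i.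
Qed.

(** Rank one operators separate the factors; this is what allows the bounds of
    the tensor family to be tested on pairs of vectors. *)
Lemma energy_rank1 y x : energy WV wv (rank1 y x) = (energy W w y * energy V v x)%E.
Proof.
rewrite -esum_prod; try by move=> ?; exact: sqr_mul_ge0.
apply: eq_esum => p _; rewrite /tensor_family (proj_tensor (cW p.1) (cV p.2)).
by rewrite tensor_proj_rank1 nrm_rank1 -EFinM /tensor_weight; congr EFin; ring.
Qed.

End TensorFamily.

(** * Rayleigh quotients and Riesz quotients *)

Section Rayleigh.
Variables (R : realType) (F : scalarField R) (K : hilbertType F).
Variables (I : choiceType) (U : I -> set K) (u : I -> R).

(** The Bessel and frame bounds of the family are the bounds of this set of
    reals, provided that all energies are finite. *)
Definition rayleigh : set R :=
  [set r | exists2 f, f != 0 & energy U u f = (r * nrm f ^+ 2)%:E].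

Lemma energy_rayleigh f r : f != 0 -> energy U u f = r%:E ->
  rayleigh (r / nrm f ^+ 2) /\ energy U u f = (r / nrm f ^+ 2 * nrm f ^+ 2)%:E.
Proof.
move=> f0 Er; have E : energy U u f = (r / nrm f ^+ 2 * nrm f ^+ 2)%:E.
  by rewrite Er divfK// gt_eqF// nrm_sqr_gt0.
by split=> //; exists f.
Qed.

Hypothesis cU : forall i, closed_subspace (U i).

Lemma rayleigh_gt0 : (forall i, 0 < u i) ->
  (forall f, exists r : R, energy U u f = r%:E) -> nonzero_family U ->
  exists2 r, rayleigh r & 0 < r.
Proof.
move=> u0 fin /(energy_gt0 cU u0)[f f0 ef]; have [r Er] := fin f.
have [Pr _] := energy_rayleigh f0 Er; exists (r / nrm f ^+ 2) => //.
by rewrite divr_gt0 ?nrm_sqr_gt0// -lte_fin -Er.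
Qed.

Lemma bessel_rayleigh B : (forall f, exists r : R, energy U u f = r%:E) ->
  (forall r, rayleigh r -> r <= B) -> bessel_fusion_sequence U u B.
Proof.
move=> fin PB f; rewrite -/(energy U u f).
have [->|f0] := eqVneq f 0; first by rewrite energy0// nrm0 expr0n mulr0.
have [r /(energy_rayleigh f0)[Pr ->]] := fin f.
by rewrite lee_fin ler_pM2r ?nrm_sqr_gt0// PB.
Qed.

Lemma frame_rayleigh A B : (forall f, exists r : R, energy U u f = r%:E) ->
  0 < A <= B -> (forall r, rayleigh r -> A <= r <= B) -> fusion_frame U u A B.
Proof.
move=> fin /andP[A0 AB] PAB; split=> //.
  by apply: bessel_rayleigh => // r /PAB /andP[].
move=> f; rewrite -/(energy U u f).
have [->|f0] := eqVneq f 0; first by rewrite energy0// nrm0 expr0n mulr0.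
have [r /(energy_rayleigh f0)[/PAB /andP[Ar _] ->]] := fin f.
by rewrite lee_fin ler_pM2r ?nrm_sqr_gt0.
Qed.

Definition riesz_ratio : set R :=
  [set r | exists (D : {fset I}) (f : I -> K),
    [/\ forall i, i \in D -> U i (f i), 0 < \sum_(i <- D) nrm (f i) ^+ 2 &
     nrm (\sum_(i <- D) ofR F (u i) *: f i) ^+ 2 = r * \sum_(i <- D) nrm (f i) ^+ 2]].

Lemma riesz_ratio_ge0 r : riesz_ratio r -> 0 <= r.
Proof. by move=> [D [f [_ s0 Er]]]; rewrite -(pmulr_lge0 _ s0) -Er sqr_ge0. Qed.

(** Families [f] with a vanishing sum of squares have no quotient, but for them
    all three sides of the Riesz inequalities vanish. *)
Lemma riesz_riesz_ratio A B : 0 < A <= B ->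
  (forall r, riesz_ratio r -> A <= r <= B) -> fusion_riesz_sequence U u A B.
Proof.
move=> /andP[A0 AB] PAB; split=> // D f Uf.
set s := \sum_(i <- D) nrm (f i) ^+ 2; set t := nrm _ ^+ 2.
have : 0 <= s by apply: sumr_ge0 => i _; exact: sqr_ge0.
rewrite le_eqVlt => /predU1P[s0|s0].
  rewrite -s0 !mulr0; suff -> : t = 0 by rewrite lexx.
  rewrite /t big1_seq ?nrm0 ?expr0n// => i /= iD.
  have /eqP := esym s0; rewrite psumr_eq0 => [|j _]; last exact: sqr_ge0.
  by move=> /allP /(_ _ iD) /=; rewrite sqrf_eq0 => /eqP /nrm_eq0 ->; rewrite scaler0.
have E : t = t / s * s by rewrite divfK// gt_eqF.
have /PAB /andP[At tB] : riesz_ratio (t / s) by exists D, f.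
by rewrite E !ler_pM2r// At tB.
Qed.

Lemma riesz_ratio0 r : ~ nonzero_family U -> ~ riesz_ratio r.
Proof.
move=> nU [D [f [Uf + _]]]; apply/negP; rewrite -leNgt big1_seq// => i /= iD.
rewrite (_ : f i = 0) ?nrm0 ?expr0n//; apply: contrapT => /eqP fi.
by apply: nU; exists i, (f i); split=> //; exact: Uf.
Qed.

Lemma riesz_ratio_neq0 : nonzero_family U -> riesz_ratio !=set0.
Proof.
move=> [i [f [Uf f0]]].
exists (nrm (ofR F (u i) *: f) ^+ 2 / nrm f ^+ 2), [fset i]%fset, (fun=> f).
rewrite !big_seq_fset1 nrm_sqr_gt0 ?divfK ?gt_eqF ?nrm_sqr_gt0//.
by split=> // j; rewrite inE => /eqP ->.
Qed.

End Rayleigh.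

(** * From the tensor product to the factors *)

Section TensorConverse.
Variables (R : realType) (F : scalarField R) (H : hilbertType F).
Variables (J I : choiceType) (W : J -> set H) (V : I -> set H).
Variables (w : J -> R) (v : I -> R).
Hypothesis cW : forall j, closed_subspace (W j).
Hypothesis cV : forall i, closed_subspace (V i).
Hypothesis w_gt0 : forall j, 0 < w j.
Hypothesis v_gt0 : forall i, 0 < v i.
Local Notation WV := (tensor_family W V).
Local Notation wv := (tensor_weight w v).

Lemma bessel_rank1 B y x : bessel_fusion_sequence WV wv B ->
  (energy W w y * energy V v x <= (B * (nrm y ^+ 2 * nrm x ^+ 2))%:E)%E.
Proof. by rewrite -exprMn -nrm_rank1 -energy_rank1//; apply. Qed.

(** A vector [x] with positive energy for [V] exists, and the bound on the product
    of the energies of [y] and [x] then makes that of [y] finite. *)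
Lemma energyW_fin B y : nonzero_family V -> bessel_fusion_sequence WV wv B ->
  exists r : R, energy W w y = r%:E.
Proof.
move=> nV hB; have [x _ x0] := energy_gt0 cV v_gt0 nV.
apply: mule_fin x0 (energy_ge0 W w y) _; rewrite muleC; exact: bessel_rank1 hB.
Qed.

Lemma energyV_fin B x : nonzero_family W -> bessel_fusion_sequence WV wv B ->
  exists r : R, energy V v x = r%:E.
Proof.
move=> nW hB; have [y _ y0] := energy_gt0 cW w_gt0 nW.
exact: mule_fin y0 (energy_ge0 V v x) (bessel_rank1 y x hB).
Qed.

Lemma rayleigh_tensor_le B p q : bessel_fusion_sequence WV wv B ->
  rayleigh W w p -> rayleigh V v q -> p * q <= B.
Proof.
move=> hB [y y0 Ey] [x x0 Ex]; have := bessel_rank1 y x hB.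
by rewrite Ey Ex -EFinM lee_fin mulrACA ler_pM2r// mulr_gt0// nrm_sqr_gt0.
Qed.

Lemma bessel_tensor_inv B : (nonzero_family W <-> nonzero_family V) ->
  bessel_fusion_sequence WV wv B ->
  exists BW BV, [/\ B = BV * BW,
    bessel_fusion_sequence W w BW & bessel_fusion_sequence V v BV].
Proof.
move=> WVn hB; have [nV|nV] := pselect (nonzero_family V).
  have nW : nonzero_family W by apply/WVn.
  have finW y := energyW_fin y nV hB; have finV x := energyV_fin x nW hB.
  have [b [c [_ E hb hc]]] := factor_upper
    (rayleigh_gt0 cW w_gt0 finW nW) (rayleigh_gt0 cV v_gt0 finV nV)
    (fun p q => @rayleigh_tensor_le B p q hB).
  by exists b, c; split => //; exact: bessel_rayleigh.
have nW : ~ nonzero_family W by move/WVn.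
have bessel0 (c : R) (L : choiceType) (U : L -> set H) (u : L -> R) :
    (forall l, closed_subspace (U l)) -> ~ nonzero_family U ->
    ((exists f : H, f != 0) -> 0 <= c) -> bessel_fusion_sequence U u c.
  move=> cU nU c0 f; rewrite -/(energy U u f) energy_eq0//.
  have [->|f0] := eqVneq f 0; first by rewrite nrm0 expr0n mulr0.
  by rewrite lee_fin mulr_ge0 ?sqr_ge0// c0//; exists f.
exists B, 1; rewrite mul1r; split=> //; last exact: bessel0.
apply: bessel0 => // -[f f0].
apply: (bessel_ge0 hB); exists (rank1 f f); apply: contra_neq f0 => ff0.
by apply: nrm_eq0; apply/eqP; rewrite -sqrf_eq0 expr2 -nrm_rank1 ff0 nrm0.
Qed.

(** The lower bound makes both families nonzero as soon as the Hilbert space is: the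
    energies of a nonzero vector have product at least a positive number. *)
Lemma frame_tensor_inv A B : fusion_frame WV wv A B ->
  exists AW BW AV BV, [/\ A = AV * AW, B = BV * BW,
    fusion_frame W w AW BW & fusion_frame V v AV BV].
Proof.
move=> [A0 AB bB bA].
have lower y x : ((A * (nrm y ^+ 2 * nrm x ^+ 2))%:E <= energy W w y * energy V v x)%E.
  by rewrite -exprMn -nrm_rank1 -energy_rank1//; apply: bA.
have [[f f0]|H0] := pselect (exists f : H, f != 0); last first.
  have H0' (f : H) : f = 0 by apply: contrapT => /eqP f0; apply: H0; exists f.
  have trivial_frame (a b : R) (L : choiceType) (U : L -> set H) (u : L -> R) :
      (forall l, closed_subspace (U l)) -> 0 < a <= b -> fusion_frame U u a b.
    move=> cU ab; apply: frame_rayleigh => // [f|r [f /eqP []//]].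
    by exists 0; rewrite (H0' f) energy0.
  exists A, B, 1, 1; rewrite !mul1r; split=> //; apply: trivial_frame => //.
    by rewrite A0.
  by rewrite ltr01 lexx.
have lower_gt0 y x : y != 0 -> x != 0 -> (0 < energy W w y * energy V v x)%E.
  move=> y0 x0; apply: lt_le_trans (lower y x).
  by rewrite lte_fin mulr_gt0// mulr_gt0// nrm_sqr_gt0.
have nW : nonzero_family W.
  apply: contrapT => nW; have := lower_gt0 _ _ f0 f0.
  by rewrite (energy_eq0 _ cW)// mul0e ltxx.
have nV : nonzero_family V.
  apply: contrapT => nV; have := lower_gt0 _ _ f0 f0.
  by rewrite (energy_eq0 _ cV)// mule0 ltxx.
have finW y := energyW_fin y nV bB; have finV x := energyV_fin x nW bB.
have [p Pp p0] := rayleigh_gt0 cW w_gt0 finW nW.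
have [q Pq q0] := rayleigh_gt0 cV v_gt0 finV nV.
have PQ r s : rayleigh W w r -> rayleigh V v s -> A <= r * s <= B.
  move=> Pr Ps; rewrite (rayleigh_tensor_le bB Pr Ps) andbT.
  have [y y0 Ey] := Pr; have [x x0 Ex] := Ps.
  have := lower y x; rewrite Ey Ex -EFinM lee_fin [leRHS]mulrACA.
  by rewrite ler_pM2r// mulr_gt0// nrm_sqr_gt0.
have [r Pr|s Ps|AW [BW [AV [BV [EA EB [AWB hW] [AVB hV]]]]]] :=
    factor_bounds (ex_intro _ p Pp) (ex_intro _ q Pq) _ _ A0 PQ.
- by have /andP[/(lt_le_trans A0)] := PQ _ _ Pr Pq; rewrite pmulr_lgt0.
- by have /andP[/(lt_le_trans A0)] := PQ _ _ Pp Ps; rewrite pmulr_rgt0.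
by exists AW, BW, AV, BV; split=> //; exact: frame_rayleigh.
Qed.

(** The operators [rank1 (y j) (x i)] indexed by a rectangle belong to the tensor
    family, and both their weighted sum and their sum of squares factor. *)
Lemma riesz_ratio_tensor A B p q : fusion_riesz_sequence WV wv A B ->
  riesz_ratio W w p -> riesz_ratio V v q -> A <= p * q <= B.
Proof.
move=> [A0 AB hR] [D [y [Wy sy Ey]]] [E [x [Vx sx Ex]]].
pose DE : {fset J * I} := fsetM D E.
have DEP j i : ((j, i) \in DE) = (j \in D) && (i \in E) by rewrite in_fsetM.
have sumDE (M : nmodType) (g : J * I -> M) :
    \sum_(k <- DE) g k = \sum_(i <- E) \sum_(j <- D) g (j, i).
  rewrite (@sum_fset_pair _ _ _ D E); last by move=> [j i]; rewrite DEP => /andP.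
  apply: eq_big_seq => i iE; apply: eq_big_seq => j jD.
  by rewrite DEP jD iE.
have WVyx k : k \in DE -> WV k (rank1 (y k.1) (x k.2)).
  by case: k => j i; rewrite DEP => /andP[/Wy Wj /Vx Vi]; exact: tensor_rank1.
have := hR DE (fun k => rank1 (y k.1) (x k.2)) WVyx.
rewrite !sumDE /=.
have -> : \sum_(i <- E) \sum_(j <- D) nrm (rank1 (y j) (x i)) ^+ 2 =
    (\sum_(j <- D) nrm (y j) ^+ 2) * \sum_(i <- E) nrm (x i) ^+ 2.
  rewrite mulr_sumr; apply: eq_bigr => i _; rewrite mulr_suml.
  by apply: eq_bigr => j _; rewrite nrm_rank1 exprMn.
have -> : \sum_(i <- E) \sum_(j <- D) ofR F (wv (j, i)) *: rank1 (y j) (x i) =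
    rank1 (\sum_(j <- D) ofR F (w j) *: y j) (\sum_(i <- E) ofR F (v i) *: x i).
  rewrite -sum_rank1; apply: eq_bigr => i _; apply: eq_bigr => j _.
  apply: S2_ext => z; rewrite rank1E (ipZl (inner_ip H)) cj_ofR scalerA.
  by rewrite /tensor_weight rmorphM -[_ *: rank1 _ _]addr0 S2E addr0 scalerA mulrAC.
rewrite nrm_rank1 exprMn Ey Ex mulrACA => /andP[lo up].
by rewrite -(ler_pM2r (mulr_gt0 sy sx)) lo -(ler_pM2r (mulr_gt0 sy sx)).
Qed.

Lemma riesz_tensor_inv A B : (nonzero_family W <-> nonzero_family V) ->
  fusion_riesz_sequence WV wv A B ->
  exists AW BW AV BV, [/\ A = AV * AW, B = BV * BW,
    fusion_riesz_sequence W w AW BW & fusion_riesz_sequence V v AV BV].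
Proof.
move=> WVn hR; have [A0 AB _] := hR.
have [nV|nV] := pselect (nonzero_family V); last first.
  have nW : ~ nonzero_family W by move/WVn.
  exists A, B, 1, 1; rewrite !mul1r; split=> //; apply: riesz_riesz_ratio.
  - by rewrite A0.
  - by move=> r /(riesz_ratio0 nW).
  - by rewrite ltr01 lexx.
  - by move=> r /(riesz_ratio0 nV).
have nW : nonzero_family W by apply/WVn.
have [p Pp] := riesz_ratio_neq0 w nW; have [q Pq] := riesz_ratio_neq0 v nV.
have PQ r s := @riesz_ratio_tensor A B r s hR.
have [r Pr|s Ps|AW [BW [AV [BV [EA EB [AWB hW] [AVB hV]]]]]] :=
    factor_bounds (ex_intro _ p Pp) (ex_intro _ q Pq) _ _ A0 PQ.
- have /andP[/(lt_le_trans A0) rq _] := PQ _ _ Pr Pq.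
  rewrite lt_def (riesz_ratio_ge0 Pr) andbT.
  by apply: contraTneq rq => ->; rewrite mul0r ltxx.
- have /andP[/(lt_le_trans A0) rq _] := PQ _ _ Pp Ps.
  rewrite lt_def (riesz_ratio_ge0 Ps) andbT.
  by apply: contraTneq rq => ->; rewrite mulr0 ltxx.
by exists AW, BW, AV, BV; split=> //; exact: riesz_riesz_ratio.
Qed.

End TensorConverse.

(** * Equivalence of bounds for the factors and the tensor product *)

Theorem theorem5p4 (R : realType) (F : scalarField R) (H : hilbertType F)
    (I : choiceType) (W V : I -> set H) (w v : I -> R)
    (W_closed : forall i, closed_subspace (W i))
    (V_closed : forall i, closed_subspace (V i))
    (w_gt0 : forall i, 0 < w i) (v_gt0 : forall i, 0 < v i) :
  let WV (ji : I * I) : set (S2 H) := tensor (W ji.1) (V ji.2) in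
  let wv (ji : I * I) : R := v ji.2 * w ji.1 in
  [/\ (forall B_W B_V : R,
        bessel_fusion_sequence W w B_W -> bessel_fusion_sequence V v B_V ->
        bessel_fusion_sequence WV wv (B_V * B_W)) /\
      ((nonzero_family W <-> nonzero_family V) ->
       forall B : R, bessel_fusion_sequence WV wv B ->
       exists B_W B_V : R, [/\ B = B_V * B_W,
         bessel_fusion_sequence W w B_W & bessel_fusion_sequence V v B_V]),
      (forall A_W B_W A_V B_V : R,
        fusion_frame W w A_W B_W -> fusion_frame V v A_V B_V ->
        fusion_frame WV wv (A_V * A_W) (B_V * B_W)) /\
      (forall A B : R, fusion_frame WV wv A B ->
       exists A_W B_W A_V B_V : R, [/\ A = A_V * A_W, B = B_V * B_W,
         fusion_frame W w A_W B_W & fusion_frame V v A_V B_V]) &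
      (forall A_W B_W A_V B_V : R,
        fusion_riesz_sequence W w A_W B_W -> fusion_riesz_sequence V v A_V B_V ->
        fusion_riesz_sequence WV wv (A_V * A_W) (B_V * B_W)) /\
      ((nonzero_family W <-> nonzero_family V) ->
       forall A B : R, fusion_riesz_sequence WV wv A B ->
       exists A_W B_W A_V B_V : R, [/\ A = A_V * A_W, B = B_V * B_W,
         fusion_riesz_sequence W w A_W B_W & fusion_riesz_sequence V v A_V B_V])].
Proof.
move=> WV wv; split; split.
- by move=> BW BV; exact: bessel_tensor.
- by move=> WVn B; exact: bessel_tensor_inv.
- by move=> AW BW AV BV; exact: frame_tensor.
- by move=> A B; exact: frame_tensor_inv.
- by move=> AW BW AV BV; exact: riesz_tensor.
- by move=> WVn A B; exact: riesz_tensor_inv.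
Qed.
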